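(* Let $X$ be a non-compact completely regular space, $e : X \to Y$ a compactification, and $\alpha = e^\flat : C(Y ) \to B(X)$, $e^\flat(f)=f\circ e$, the corresponding basic extension. The following are equivalent. (1) $\alpha$ is minimal. (2) $X$ is locally compact and $e : X \to Y$ is equivalent to the one-point compactification of $X$. (3) $\alpha$ is locally compact and $J_\ell(I_\alpha)$ is a maximal $\ell$-ideal of $C(Y)$.
   Context: Completely regular spaces are Hausdorff. A compactification of a completely regular space $X$ is a topological embedding $e:X\to Y$ into a compact Hausdorff space $Y$ with $e[X]$ dense in $Y$. Compactifications $e:X\to Y$ and $e':X\to Y'$ are equivalent if there is a homeomorphism $f:Y'\to Y$ with $f\circ e'=e$. $C(Y)$ is the $\ell$-algebra of continuous real-valued functions on $Y$, and $B(X)$ the $\ell$-algebra of all bounded real-valued functions on $X$, with pointwise operations and order. An $\ell$-ring is a ring $A$ with $1$ and a partial order $\le$ making $A$ a lattice, such that $a\le b$ implies $a+c\le b+c$, and $0\le a,b$ implies $0\le ab$. It is bounded if for each $a$ there is $n\in\mathbb N$ with $a\le n\cdot 1$; archimedean if $na\le b$ for all $n\in\mathbb N$ implies $a\le 0$; an $\ell$-algebra if it is an $\mathbb R$-algebra and $0\le a\in A$, $0\le r\in\mathbb R$ imply $0\le ra$. Let $\mathbf{bal}$ be the category of bounded archimedean $\ell$-algebras and unital $\ell$-algebra homomorphisms. Real numbers $r$ are identified with $r\cdot 1$, and $|a|=a\vee(-a)$. $A\in\mathbf{bal}$ is uniformly complete if it is complete in the norm $\|a\|=\inf\{r\in\mathbb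 R: |a|\le r\}$; $\mathbf{ubal}$ is the full subcategory of $\mathbf{bal}$ of uniformly complete objects. A basic algebra is a $B\in\mathbf{bal}$ that is Dedekind complete (each nonempty subset bounded above has a supremum) and whose boolean algebra of idempotents is atomic. A basic extension is a monomorphism $\alpha:A\to B$ in $\mathbf{bal}$, with $B$ a basic algebra, such that each element of $B$ is a join of meets of elements of $\alpha[A]$. Each $e^\flat$ is a basic extension. An $\ell$-ideal of $A\in\mathbf{bal}$ is an ideal $I$ such that $|a|\le|b|$ and $b\in I$ imply $a\in I$. $Y_A$ is the compact Hausdorff space of maximal $\ell$-ideals of $A$, with closed sets $\{M\in Y_A: I\subseteq M\}$, $I$ an $\ell$-ideal; $X_A$ is the set of isolated points of $Y_A$. For a basic extension $\alpha:A\to B$ let $\alpha_\flat:X_B\to Y_A$, $\alpha_\flat(M)=\alpha^{-1}(M)$, and let $\tau_\alpha$ be the least topology on $X_B$ making $\alpha_\flat$ continuous. Basic extensions $\alpha:A\to B$ and $\gamma:C\to B$ are compatible if $\tau_\alpha=\tau_\gamma$. A basic extension $\alpha:A\to B$ is minimal if for every compatible basic extension $\gamma:C\to B$ with $C\in\mathbf{ubal}$ there is a morphism $\delta:A\to C$ in $\mathbf{bal}$ with $\gamma\circ\delta=\alpha$. An element $a\in A$ is $\alpha$-compact if for every real $\varepsilon>0$ and every subset $T$ of nonnegative elements of $A$, $|\alpha(a)|+\varepsilon\le\bigvee\alpha[T]$ (join presupposed to exist in $B$) implies that there is a finite subset $T'$ of $T$ with $|\alpha(a)|\le\bigvee\alpha[T']$;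 $I_\alpha=\{a\in A\mid a\text{ is }\alpha\text{-compact}\}$, which is an $\ell$-ideal of $A$. A basic extension $\alpha:A\to B$ is locally compact if $\alpha(b)=\bigvee\{\alpha(a)\mid a\in I_\alpha, a\le b\}$ for all $0\le b\in A$. For an $\ell$-ideal $I$ of $A$, $J_\ell(I)=\bigcap\{M\in Y_A\mid I\subseteq M\}$. *)

(* Defs.v *)
From HB Require Import structures.
From mathcomp Require Import all_boot all_order all_algebra.
From mathcomp Require Import all_classical all_reals all_analysis.
From mathcomp Require Import ring.

Set Implicit Arguments.
Unset Strict Implicit.
Unset Printing Implicit Defensive.

Import Order.TTheory GRing.Theory Num.Theory.
Import numFieldNormedType.Exports.

Local Open Scope classical_set_scope.
Local Open Scope ring_scope.

(* Hierarchy Builder cannot join a lattice with a possibly trivial ring that is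
   also a module (MathComp's algebras are nontrivial, whereas C(Y) must be an
   algebra for every Y).  The operations are therefore packed by hand, and each
   MathComp structure is then declared on the carrier. *)
Record lAlgebra (R : realType) := LAlgebra {
  lsort :> Type;
  lzero : lsort;
  lone : lsort;
  lopp : lsort -> lsort;
  ladd : lsort -> lsort -> lsort;
  lmul : lsort -> lsort -> lsort;
  lscale : R -> lsort -> lsort;
  lle : lsort -> lsort -> Prop;
  lmeet : lsort -> lsort -> lsort;
  ljoin : lsort -> lsort -> lsort;
  laddA : associative ladd;
  laddC : commutative ladd;
  ladd0 : left_id lzero ladd;
  laddN : left_inverse lzero lopp ladd;
  lmulA : associative lmul;
  lmul1l : left_id lone lmul;
  lmul1r : right_id lone lmul;
  lmulDl : left_distributive lmul ladd;
  lmulDr : right_distributive lmul ladd;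
  lscaleA : forall r s a, lscale r (lscale s a) = lscale (r * s) a;
  lscale1 : forall a, lscale 1 a = a;
  lscaleDr : forall r a b, lscale r (ladd a b) = ladd (lscale r a) (lscale r b);
  lscaleDl : forall r s a, lscale (r + s) a = ladd (lscale r a) (lscale s a);
  lscaleAl : forall r a b, lscale r (lmul a b) = lmul (lscale r a) b;
  lscaleAr : forall r a b, lscale r (lmul a b) = lmul a (lscale r b);
  lle_refl : forall a, lle a a;
  lle_anti : forall a b, lle a b -> lle b a -> a = b;
  lle_trans : forall a b c, lle a b -> lle b c -> lle a c;
  lle_meet : forall a b c, lle a (lmeet b c) <-> lle a b /\ lle a c;
  ljoin_le : forall a b c, lle (ljoin a b) c <-> lle a c /\ lle b c;
  lle_add : forall a b c, lle a b -> lle (ladd a c) (ladd b c);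
  lmul_ge0 : forall a b, lle lzero a -> lle lzero b -> lle lzero (lmul a b);
  lscale_ge0 : forall r a, 0 <= r -> lle lzero a -> lle lzero (lscale r a)
}.

Section LAlgebraInstances.
Variables (R : realType) (A : lAlgebra R).

HB.instance Definition _ := gen_eqMixin (lsort A).
HB.instance Definition _ := gen_choiceMixin (lsort A).
HB.instance Definition _ := GRing.isZmodule.Build (lsort A)
  (@laddA R A) (@laddC R A) (@ladd0 R A) (@laddN R A).
HB.instance Definition _ := GRing.Zmodule_isPzRing.Build (lsort A)
  (@lmulA R A) (@lmul1l R A) (@lmul1r R A) (@lmulDl R A) (@lmulDr R A).

Let lscaleDl_morph (a : A) : {morph (@lscale R A)^~ a : r s / r + s}.
Proof. by move=> r s; exact: lscaleDl. Qed.

HB.instance Definition _ := GRing.Zmodule_isLmodule.Build R (lsort A)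
  (@lscaleA R A) (@lscale1 R A) (@lscaleDr R A) lscaleDl_morph.

Definition lle_bool (a b : A) : bool := `[< lle a b >].

Let lle_bool_refl : reflexive lle_bool.
Proof. by move=> a; apply/asboolP/lle_refl. Qed.
Let lle_bool_anti : antisymmetric lle_bool.
Proof. by move=> a b /andP[/asboolP ab /asboolP]; exact: lle_anti. Qed.
Let lle_bool_trans : transitive lle_bool.
Proof.
by move=> b a c /asboolP ab /asboolP bc; apply/asboolP; exact: lle_trans bc.
Qed.

HB.instance Definition _ := Order.Le_isPOrder.Build ring_display (lsort A)
  lle_bool_refl lle_bool_anti lle_bool_trans.

Let lmeetP (a b c : A) : (a <= lmeet b c) = (a <= b) && (a <= c).
Proof.
by apply/asboolP/andP => [/lle_meet[? ?]|[/asboolP ? /asboolP ?]];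
  [split; apply/asboolP|apply/lle_meet].
Qed.
Let ljoinP (a b c : A) : (ljoin a b <= c) = (a <= c) && (b <= c).
Proof.
by apply/asboolP/andP => [/ljoin_le[? ?]|[/asboolP ? /asboolP ?]];
  [split; apply/asboolP|apply/ljoin_le].
Qed.

HB.instance Definition _ := Order.POrder_MeetJoin_isLattice.Build ring_display
  (lsort A) lmeetP ljoinP.

End LAlgebraInstances.

Record lAlgHom (R : realType) (A B : lAlgebra R) := LAlgHom {
  lhom :> A -> B;
  lhomD : forall a b, lhom (a + b) = lhom a + lhom b;
  lhomZ : forall (r : R) a, lhom (r *: a) = r *: lhom a;
  lhomM : forall a b, lhom (a * b) = lhom a * lhom b;
  lhom1 : lhom 1 = 1;
  lhomI : forall a b, lhom (Order.meet a b) = Order.meet (lhom a) (lhom b);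
  lhomU : forall a b, lhom (Order.join a b) = Order.join (lhom a) (lhom b)
}.

Section Bal.
Context {R : realType}.
Implicit Types A B C Z : lAlgebra R.

Definition lreal A (r : R) : A := r *: (1 : A).

Definition labs A (a : A) : A := Order.join a (- a).

Definition bounded_lalg A := forall a : A, exists n : nat, a <= n%:R.

Definition archimedean_lalg A :=
  forall a b : A, (forall n : nat, a *+ n <= b) -> a <= 0.

Definition bal A := bounded_lalg A /\ archimedean_lalg A.

Definition lnorm A (a : A) : R := inf [set r : R | labs a <= lreal A r].

Definition uniformly_complete A :=
  forall u : nat -> A,
    (forall eps : R, 0 < eps -> exists N : nat, forall m n : nat,
       (N <= m)%N -> (N <= n)%N -> lnorm (u m - u n) < eps) ->
    exists a : A, lnorm (u n - a) @[n --> \oo] --> (0 : R).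

Definition ubal A := bal A /\ uniformly_complete A.

Definition dedekind_complete A :=
  forall S : set A, has_sup S -> supremums S !=set0.

Definition idempotents A : set A := [set p | p * p = p].

(* The order of the boolean algebra of idempotents is q <= p iff q * p = q. *)
Definition idempotent_atom A (p : A) :=
  [/\ idempotents p, p <> 0 &
      forall q, idempotents q -> q * p = q -> q = 0 \/ q = p].

Definition atomic_idempotents A :=
  forall p : A, idempotents p -> p <> 0 ->
    exists2 q, idempotent_atom q & q * p = q.

Definition basic_algebra B :=
  [/\ bal B, dedekind_complete B & atomic_idempotents B].

Definition bal_monomorphism A B (alpha : lAlgHom A B) :=
  forall Z, bal Z -> forall f g : lAlgHom Z A,
    alpha \o f =1 alpha \o g -> f =1 g.

Definition join_of_meets B (S : set B) (b : B) :=
  exists F : set B, supremums F b /\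
    forall m, F m -> exists2 T : set B, T `<=` S & infimums T m.

Definition basic_extension A B (alpha : lAlgHom A B) :=
  [/\ bal A, basic_algebra B, bal_monomorphism alpha &
      forall b : B, join_of_meets (range alpha) b].

Definition lideal A (I : set A) :=
  [/\ I 0,
      forall a b, I a -> I b -> I (a + b),
      forall x a, I a -> I (x * a) /\ I (a * x) &
      forall a b, labs a <= labs b -> I b -> I a].

Definition maximal_lideal A (M : set A) :=
  [/\ lideal M, M <> setT &
      forall I, lideal I -> M `<=` I -> I = M \/ I = setT].

(* Y_A and X_A are sets of subsets of A, and the topologies on Y_A and X_B are
   given by their families of open subsets. *)
Definition Yset A : set (set A) := [set M | maximal_lideal M].

Definition Yclosed A : set (set (set A)) :=
  [set F | exists2 I, lideal I & F = [set M | Yset M /\ I `<=` M]].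

Definition Yopen A : set (set (set A)) :=
  [set U | U `<=` @Yset A /\ Yclosed (@Yset A `\` U)].

Definition Xset A : set (set A) := [set M | Yset M /\ Yopen [set M]].

Definition flat_map A B (alpha : lAlgHom A B) (M : set B) : set A :=
  alpha @^-1` M.

(* The least topology making a map continuous consists of the preimages of the
   open sets. *)
Definition tau A B (alpha : lAlgHom A B) : set (set (set B)) :=
  [set U | exists2 V, Yopen V & U = @Xset B `&` flat_map alpha @^-1` V].

Definition compatible A C B (alpha : lAlgHom A B) (gamma : lAlgHom C B) :=
  tau alpha = tau gamma.

Definition minimal_extension A B (alpha : lAlgHom A B) :=
  basic_extension alpha /\
  forall C (gamma : lAlgHom C B),
    ubal C -> basic_extension gamma -> compatible alpha gamma ->
    exists delta : lAlgHom A C, gamma \o delta =1 alpha.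

(* [supremums S] is empty when S has no least upper bound, so that all joins
   are required to exist where they are used. *)
Definition alpha_compact A B (alpha : lAlgHom A B) (a : A) :=
  forall (eps : R) (T : set A) (s : B),
    0 < eps -> (forall t, T t -> 0 <= t) ->
    supremums (alpha @` T) s -> labs (alpha a) + lreal B eps <= s ->
    exists T' : set A, [/\ finite_set T', T' `<=` T &
      exists2 s', supremums (alpha @` T') s' & labs (alpha a) <= s'].

Definition Icompact A B (alpha : lAlgHom A B) : set A :=
  [set a | alpha_compact alpha a].

Definition locally_compact_extension A B (alpha : lAlgHom A B) :=
  basic_extension alpha /\
  forall b : A, 0 <= b ->
    supremums (alpha @` [set a | Icompact alpha a /\ a <= b]) (alpha b).

Definition Jl A (I : set A) : set A :=
  \bigcap_(M in [set M | Yset M /\ I `<=` M]) M.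

End Bal.

Section Compactifications.
Context {X : topologicalType}.

Definition topological_embedding (Y : topologicalType) (e : X -> Y) :=
  [/\ injective e, continuous e &
      forall U, open U -> exists2 V, open V & e @` U = V `&` range e].

Definition compactification (Y : topologicalType) (e : X -> Y) :=
  [/\ compact [set: Y], hausdorff_space Y, topological_embedding e &
      dense (range e)].

Definition equivalent_compactifications (Y Y' : topologicalType)
    (e : X -> Y) (e' : X -> Y') :=
  exists (f : Y' -> Y) (g : Y -> Y'),
    [/\ continuous f, continuous g, cancel f g, cancel g f & f \o e' =1 e].

End Compactifications.

Section FunctionAlgebra.
Variables (R : realType) (T : Type).

(* The sets of functions containing the constants and closed under the
   pointwise operations. *)
Record funClass := FunClass {
  funset : set (T -> R);
  funset_cst : forall c, funset (fun=> c);
  funset_add : forall f g, funset f -> funset g -> funset (fun x => f x + g x);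
  funset_mul : forall f g, funset f -> funset g -> funset (fun x => f x * g x);
  funset_min : forall f g, funset f -> funset g ->
    funset (fun x => Num.min (f x) (g x));
  funset_max : forall f g, funset f -> funset g ->
    funset (fun x => Num.max (f x) (g x))
}.

Record funIn (S : funClass) := FunIn { funval :> T -> R; funvalP : funset S funval }.

Variable S : funClass.
Implicit Types f g h : funIn S.

Lemma funInP f g : f =1 g -> f = g.
Proof.
case: f g => [f fP] [g gP] /= /funext fg; subst g.
by rewrite (Prop_irrelevance fP gP).
Qed.

Let cst_ c := FunIn (funset_cst S c).
Let add f g := FunIn (funset_add (funvalP f) (funvalP g)).
Let mul f g := FunIn (funset_mul (funvalP f) (funvalP g)).
Let meet f g := FunIn (funset_min (funvalP f) (funvalP g)).
Let join f g := FunIn (funset_max (funvalP f) (funvalP g)).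
Let scale r f := mul (cst_ r) f.

Definition funAlgebra : lAlgebra R.
Proof.
refine (@LAlgebra R (funIn S) (cst_ 0) (cst_ 1) (scale (-1)) add mul scale
  (fun f g => forall x, f x <= g x) meet join
  _ _ _ _ _ _ _ _ _ _ _ _ _ _ _ _ _ _ _ _ _ _ _);
  try by move=> *; apply: funInP => x /=; ring.
- by [].
- by move=> f g fg gf; apply: funInP => x; apply/le_anti; rewrite fg gf.
- by move=> f g h fg gh x; exact: le_trans (gh x).
- move=> f g h; split=> [fgh|[fg fh] x /=]; last by rewrite le_min fg fh.
  by split=> x; have := fgh x; rewrite /= le_min => /andP[].
- move=> f g h; split=> [fgh|[fh gh] x /=]; last by rewrite ge_max fh gh.
  by split=> x; have := fgh x; rewrite /= ge_max => /andP[].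
- by move=> f g h fg x /=; rewrite lerD2r.
- by move=> f g f0 g0 x; exact: mulr_ge0 (f0 x) (g0 x).
- by move=> r f r0 f0 x; exact: mulr_ge0 r0 (f0 x).
Defined.

End FunctionAlgebra.

Section ContinuousBounded.
Variable R : realType.

Section Continuous.
Variable Y : topologicalType.

Let C : set (Y -> R) := [set f | continuous f].

Let C_cst c : C (fun=> c). Proof. by move=> y; exact: cvg_cst. Qed.
Let C_add f g : C f -> C g -> C (fun y => f y + g y).
Proof. by move=> Cf Cg y; apply: cvgD; [exact: Cf|exact: Cg]. Qed.
Let C_mul f g : C f -> C g -> C (fun y => f y * g y).
Proof. by move=> Cf Cg y; apply: cvgM; [exact: Cf|exact: Cg]. Qed.
Let C_min f g : C f -> C g -> C (fun y => Num.min (f y) (g y)).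
Proof.
by move=> Cf Cg y; apply: (@continuous_min R Y); [exact: Cf|exact: Cg].
Qed.
Let C_max f g : C f -> C g -> C (fun y => Num.max (f y) (g y)).
Proof.
by move=> Cf Cg y; apply: (@continuous_max R Y); [exact: Cf|exact: Cg].
Qed.

Definition continuousClass : funClass R Y :=
  FunClass C_cst C_add C_mul C_min C_max.

Definition Calg : lAlgebra R := funAlgebra continuousClass.

End Continuous.

Section Bounded.
Variable X : Type.

Let B : set (X -> R) := [set f | exists M, forall x, `|f x| <= M].

Let B_cst c : B (fun=> c). Proof. by exists `|c|. Qed.
Let B_add f g : B f -> B g -> B (fun x => f x + g x).
Proof.
move=> [M fM] [N gN]; exists (M + N) => x.
by rewrite (le_trans (ler_normD _ _)) // lerD.
Qed.
Let B_mul f g : B f -> B g -> B (fun x => f x * g x).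
Proof.
by move=> [M fM] [N gN]; exists (M * N) => x; rewrite normrM ler_pM.
Qed.
Let B_min f g : B f -> B g -> B (fun x => Num.min (f x) (g x)).
Proof.
move=> [M fM] [N gN]; exists (Num.max M N) => x.
by rewrite le_max; case: (leP (f x) (g x)) => _; rewrite ?fM ?gN ?orbT.
Qed.
Let B_max f g : B f -> B g -> B (fun x => Num.max (f x) (g x)).
Proof.
move=> [M fM] [N gN]; exists (Num.max M N) => x.
by rewrite le_max; case: (leP (f x) (g x)) => _; rewrite ?fM ?gN ?orbT.
Qed.

Definition boundedClass : funClass R X :=
  FunClass B_cst B_add B_mul B_min B_max.

Definition Balg : lAlgebra R := funAlgebra boundedClass.

End Bounded.

Section Eflat.
Variables (X Y : topologicalType) (e : X -> Y) (ce : compactification e).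

Let eflat_bounded (f : funIn (continuousClass Y)) : funset (boundedClass X) (f \o e).
Proof.
have [cY _ _ _] := ce.
have /compact_bounded[M [_ fM]] : compact (f @` setT).
  apply: continuous_compact cY; apply: continuous_subspaceT.
  exact: (funvalP f).
by exists (M + 1) => x; apply: (fM (M + 1)); [rewrite ltrDl|exists (e x)].
Qed.

Definition eflat : lAlgHom (Calg Y) (Balg X).
Proof.
by refine (@LAlgHom R (Calg Y) (Balg X) (fun f => FunIn (eflat_bounded f))
  _ _ _ _ _ _) => *; apply: funInP.
Defined.

End Eflat.

End ContinuousBounded.

(* Main.v *)
(* The three conditions are compared with: e misses exactly one point p of Y.

   The isolated maximal ideals of B(X) are the points of X, and the topology
   induced on them by a basic extension C -> B(X) has as open sets the unions of
   cozero sets of functions in the image of C.  Hence a basic extension is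
   compatible with e^flat exactly when these cozero sets generate the topology
   of X.

   If alpha is minimal and p, q are distinct points outside e[X], then
   {f in C(Y) | f p = f q} is a compatible extension through which alpha cannot
   factor.  Conversely, if p is the only point outside e[X], then a function f
   on Y with f p = 0 is, outside a compact subset of X, close to 0, so a
   lattice Stone-Weierstrass argument puts f o e into the uniformly closed image
   of any compatible C.

   A compact element of C(Y) vanishes at every point outside e[X], so if
   J(I_alpha) is maximal there is at most one such point; when p is the only one,
   the functions vanishing near p are compact elements, and J(I_alpha) is the
   ideal of p. *)
Require Import Defs.
From HB Require Import structures.
From mathcomp Require Import all_boot all_order all_algebra.
From mathcomp Require Import all_classical all_reals all_analysis.
From mathcomp Require Import finmap ring lra.

Set Implicit Arguments.
Unset Strict Implicit.
Unset Printing Implicit Defensive.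

Import Order.TTheory GRing.Theory Num.Theory.
Import numFieldNormedType.Exports.

Local Open Scope classical_set_scope.
Local Open Scope ring_scope.

(** * Homomorphisms of [lAlgebra]s and their ideals *)

Section Homomorphisms.
Context {R : realType}.
Implicit Types A B C : lAlgebra R.

Section Hom.
Context {A B : lAlgebra R} (h : lAlgHom A B).

Lemma lhom0 : h 0 = 0.
Proof. by rewrite -(scale0r (0 : A)) lhomZ scale0r. Qed.

Lemma lhomN a : h (- a) = - h a.
Proof. by rewrite -scaleN1r lhomZ scaleN1r. Qed.

Lemma lhomB a b : h (a - b) = h a - h b.
Proof. by rewrite lhomD lhomN. Qed.

Lemma lhomMn a n : h (a *+ n) = h a *+ n.
Proof. by elim: n => [|n ih]; rewrite ?mulr0n ?lhom0// !mulrS lhomD ih. Qed.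

Lemma lhom_real r : h (lreal A r) = lreal B r.
Proof. by rewrite /lreal lhomZ lhom1. Qed.

Lemma lhom_abs a : h (labs a) = labs (h a).
Proof. by rewrite /labs lhomU lhomN. Qed.

Lemma lhom_le a b : a <= b -> h a <= h b.
Proof. by move=> /join_idPr ab; apply/join_idPr; rewrite -lhomU ab. Qed.

(** The order is encoded by joins, so an injective homomorphism reflects it. *)
Lemma lhom_inj_le a b : injective h -> (h a <= h b) = (a <= b).
Proof.
move=> hI; apply/idP/idP; last exact: lhom_le.
by move=> /join_idPr; rewrite -lhomU => /hI ?; apply/join_idPr.
Qed.

Lemma injective_monomorphism : injective h -> bal_monomorphism h.
Proof. by move=> hI Z _ f g fg z; apply/hI/fg. Qed.

End Hom.

(** Lets results about homomorphisms into a function algebra apply to the function algebra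
    itself. *)
Definition lid A : lAlgHom A A.
Proof. by refine (@LAlgHom R A A id _ _ _ _ _ _). Defined.

Lemma lscale_mull A (r : R) (a : A) : r *: a = lreal A r * a.
Proof. by rewrite -{1}(mul1r a); exact: lscaleAl. Qed.

Lemma lideal_scale A (I : set A) r a : lideal I -> I a -> I (r *: a).
Proof. by case=> _ _ IM _ Ia; rewrite lscale_mull; case: (IM (lreal A r) _ Ia). Qed.

Lemma lideal_one A (I : set A) : lideal I -> I 1 -> I = setT.
Proof.
case=> _ _ IM _ I1; apply/seteqP; split => // a _.
by rewrite -(mulr1 a); case: (IM a _ I1).
Qed.

End Homomorphisms.

(** * Pointwise computation in algebras of functions *)

Section FunctionAlgebras.
Context {R : realType} {T : Type} {S : funClass R T}.
Implicit Types f g : funAlgebra S.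

Lemma funAlg_leP f g : reflect (forall x, f x <= g x) (f <= g).
Proof. exact: asboolP. Qed.

Lemma funAlgD f g x : (f + g) x = f x + g x. Proof. by []. Qed.
Lemma funAlgM f g x : (f * g) x = f x * g x. Proof. by []. Qed.
Lemma funAlgZ r f x : (r *: f) x = r * f x. Proof. by []. Qed.
Lemma funAlgN f x : (- f) x = - f x. Proof. exact: mulN1r. Qed.
Lemma funAlg0 x : (0 : funAlgebra S) x = 0. Proof. by []. Qed.
Lemma funAlg1 x : (1 : funAlgebra S) x = 1. Proof. by []. Qed.
Lemma funAlg_real r x : lreal (funAlgebra S) r x = r.
Proof. exact: mulr1. Qed.
Lemma funAlgB f g x : (f - g) x = f x - g x.
Proof. by rewrite funAlgD funAlgN. Qed.
Lemma funAlgMn f n x : (f *+ n) x = f x *+ n.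
Proof. by elim: n => [//|n ih]; rewrite !mulrS funAlgD ih. Qed.
Lemma funAlgI f g x : (Order.meet f g) x = Num.min (f x) (g x).
Proof. by []. Qed.
Lemma funAlgU f g x : (Order.join f g) x = Num.max (f x) (g x).
Proof. by []. Qed.
Lemma funAlg_abs f x : (labs f) x = `|f x|.
Proof. by rewrite /labs funAlgU funAlgN maxrN. Qed.

End FunctionAlgebras.

(** * Ideals of elements vanishing on a set *)

Section Vanishing.
Context {R : realType} {T : Type} {S : funClass R T} {A : lAlgebra R}.
Variable h : lAlgHom A (funAlgebra S).

(** Pulled back along [h], so that each point of [T] yields an ideal of any algebra mapped into
    functions on [T]. *)
Definition vanish (Z : set T) : set A := [set a | forall x, Z x -> h a x = 0].

Lemma vanish_lideal Z : lideal (vanish Z).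
Proof.
split.
- by move=> x _; rewrite lhom0.
- by move=> a b aZ bZ x Zx; rewrite lhomD funAlgD aZ// bZ// addr0.
- by move=> a b bZ; split=> x Zx; rewrite lhomM funAlgM bZ// ?mulr0 ?mul0r.
- move=> a b ab bZ x Zx; apply/eqP; rewrite -normr_le0.
  have /funAlg_leP/(_ x) := lhom_le h ab.
  by rewrite !lhom_abs !funAlg_abs bZ// normr0.
Qed.

Lemma vanish1P y a : vanish [set y] a <-> h a y = 0.
Proof. by split=> [|ay x ->//]; exact. Qed.

(** If [c] has a nonzero value at [y], then [1 - (h c y)^-1 *: c] vanishes at [y]; hence an ideal
    containing [c] and all of [vanish [set y]] contains [1]. *)
Lemma vanish1_maximal y : maximal_lideal (vanish [set y]).
Proof.
split; first exact: vanish_lideal.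
  move=> vT; have : vanish [set y] 1 by rewrite vT.
  by move=> /vanish1P; rewrite lhom1 funAlg1 => /eqP; rewrite oner_eq0.
move=> I Iid vI; have [Iv|] := pselect (I `<=` vanish [set y]).
  by left; apply/seteqP.
move=> /existsNP[c /not_implyP[Ic nvc]]; right.
have cy0 : h c y != 0 by apply/eqP => cy; apply: nvc; apply/vanish1P.
apply: lideal_one => //; rewrite -(subrK ((h c y)^-1 *: c) 1).
case: (Iid) => _ ID _ _; apply: ID; last exact: lideal_scale.
apply: vI; apply/vanish1P.
by rewrite lhomB lhomZ lhom1 funAlgB funAlgZ funAlg1 mulVf// subrr.
Qed.

End Vanishing.

(** * B(T) is a basic algebra; a criterion for basic extensions *)

Section BoundedFunctions.
Context {R : realType} {T : Type}.
Local Notation B := (Balg R T).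

Lemma Balg_bounded (f : B) : exists M, forall x, `|f x| <= M.
Proof. exact: (funvalP (f : funIn _)). Qed.

Definition bfun (f : T -> R) M (fM : forall x, `|f x| <= M) : B :=
  FunIn (ex_intro (fun M => forall x, `|f x| <= M) M fM :
    funset (boundedClass R T) f).

Definition spike (x : T) (r M : R) (y : T) : R := if `[< y = x >] then r else M.

Lemma spike_at x r M : spike x r M x = r.
Proof. by rewrite /spike asboolT. Qed.

Lemma spike_off x r M y : y <> x -> spike x r M y = M.
Proof. by move=> yx; rewrite /spike asboolF. Qed.

Lemma spike_bounded x r M y : `|spike x r M y| <= Num.max `|r| `|M|.
Proof. by rewrite /spike le_max; case: ifP; rewrite lexx ?orbT. Qed.

Definition bspike x r M : B := bfun (spike_bounded x r M).

Lemma bspike_at x r M : bspike x r M x = r.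
Proof. exact: spike_at. Qed.

Lemma bspike_off x r M y : y <> x -> bspike x r M y = M.
Proof. exact: spike_off. Qed.

(** Both properties hold pointwise for real values and are reflected by the injective [h]. *)
Lemma inj_bal (A : lAlgebra R) (h : lAlgHom A B) : injective h -> bal A.
Proof.
move=> hI; split=> [a|a b ab].
  have [M aM] := Balg_bounded (h a); exists (Num.truncn M).+1.
  rewrite -(lhom_inj_le _ _ hI); apply/funAlg_leP => x.
  rewrite lhomMn lhom1 funAlgMn funAlg1; apply: le_trans (ler_norm _) _.
  by rewrite (le_trans (aM x))// ltW// truncnS_gt.
rewrite -(lhom_inj_le _ _ hI) lhom0; apply/funAlg_leP => x.
rewrite funAlg0 leNgt; apply/negP => ax0.
have := lhom_le h (ab (Num.truncn (h b x / h a x)).+1).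
move=> /funAlg_leP/(_ x); rewrite lhomMn funAlgMn.
by rewrite -mulr_natl -ler_pdivlMr// leNgt truncnS_gt.
Qed.

(** Joins in B(T) are pointwise: otherwise lowering [b] by [eps] at [x] alone would give a smaller
    upper bound. *)
Lemma Balg_supremumsP (F : set B) b x : supremums F b ->
  forall eps, 0 < eps -> exists2 f, F f & b x - eps < f x.
Proof.
move=> [ub lub] eps eps0; apply: contrapT => nex.
suff : b <= b - eps *: bspike x 1 0.
  move=> /funAlg_leP/(_ x); rewrite funAlgB funAlgZ bspike_at mulr1.
  by rewrite lerBrDl gerDr leNgt eps0.
apply: lub => f Ff; apply/funAlg_leP => y; rewrite funAlgB funAlgZ.
have [->|yx] := pselect (y = x); last first.
  by rewrite bspike_off// mulr0 subr0; exact/funAlg_leP/ub.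
by rewrite bspike_at mulr1 leNgt; apply/negP => fx; apply: nex; exists f.
Qed.

(** The pointwise supremum is bounded, lying between a member [f0] of [F] and an upper bound [b]. *)
Lemma Balg_dedekind_complete : dedekind_complete B.
Proof.
move=> F [[f0 Ff0] [b ub]].
pose E x : set R := [set f x | f in F].
have Esup x : has_sup (E x).
  split; first by exists (f0 x), f0.
  by exists (b x) => _ [f Ff <-]; exact/funAlg_leP/ub.
have [M0 f0M] := Balg_bounded f0; have [Mb bM] := Balg_bounded b.
have sM x : `|sup (E x)| <= Num.max M0 Mb.
  rewrite ler_norml le_max; apply/andP; split.
    apply: (@le_trans _ _ (f0 x)).
      rewrite lerNl le_max; apply/orP; left.
      by apply: le_trans (f0M x); rewrite -normrN ler_norm.
    by apply: ub_le_sup; [case: (Esup x)|exists f0].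
  apply/orP; right; apply: (@le_trans _ _ (b x)).
    by apply: sup_le_ub; [case: (Esup x)|move=> _ [f Ff <-]; exact/funAlg_leP/ub].
  exact: le_trans (ler_norm _) (bM x).
exists (bfun sM); split=> [f Ff|c cub]; apply/funAlg_leP => x.
  by apply: ub_le_sup; [case: (Esup x)|exists f].
apply: sup_le_ub; first by case: (Esup x).
by move=> _ [f Ff <-]; exact/funAlg_leP/cub.
Qed.

(** Idempotents are the functions with values 0 and 1, and the atoms below [p] are the indicators of
    the points where [p] is 1. *)
Lemma Balg_basic : basic_algebra B.
Proof.
split; [exact: (@inj_bal B (lid B))|exact: Balg_dedekind_complete|].
have idem01 (p : B) x : idempotents p -> p x = 0 \/ p x = 1.
  move=> /(congr1 (fun f : B => f x)); rewrite funAlgM => /eqP.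
  rewrite -subr_eq0 -{3}(mulr1 (p x)) -mulrBr mulf_eq0 subr_eq0.
  by case/orP => /eqP; [left|right].
move=> p pp p0.
have [x px] : exists x, p x <> 0.
  apply: contrapT => /forallNP px; apply: p0.
  by apply: funInP => x; exact: contrapT (px x).
have {px}px : p x = 1 by case: (idem01 p x pp).
exists (bspike x 1 0).
  split.
  - apply: funInP => y; rewrite funAlgM; have [->|yx] := pselect (y = x).
      by rewrite bspike_at mulr1.
    by rewrite bspike_off// mulr0.
  - move=> /(congr1 (fun f : B => f x)); rewrite bspike_at => /eqP.
    by rewrite oner_eq0.
  - move=> q qq qx.
    have q0 y : y <> x -> q y = 0.
      by move=> yx; rewrite -qx funAlgM bspike_off// mulr0.
    case: (idem01 q x qq) => qx1; [left|right]; apply: funInP => y;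
      (have [->|yx] := pselect (y = x); first by rewrite qx1 ?bspike_at);
      by rewrite q0// bspike_off.
apply: funInP => y; rewrite funAlgM; have [->|yx] := pselect (y = x).
  by rewrite bspike_at px mulr1.
by rewrite bspike_off// mul0r.
Qed.

Lemma separating_basic_extension (A : lAlgebra R) (h : lAlgHom A B) :
  injective h ->
  (forall x y, x <> y -> exists2 a, h a x != 0 & h a y = 0) ->
  basic_extension h.
Proof.
move=> hI hsep; split; first exact: inj_bal hI.
- exact: Balg_basic.
- exact: injective_monomorphism.
move=> b; have [M bM] := Balg_bounded b.
have Mb y : - M <= b y by have := bM y; rewrite ler_norml => /andP[].
(* [b] is the join of its spikes, and scaled, shifted squares in the range of [h]
   show that each spike is the meet of the elements of that range above it. *)
exists (range (fun x => bspike x (b x) (- M))); split.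
  split=> [_ [x _ <-]|c cub]; apply/funAlg_leP => y.
    have [->|yx] := pselect (y = x); first by rewrite bspike_at.
    by rewrite bspike_off.
  have /funAlg_leP/(_ y) : bspike y (b y) (- M) <= c by apply: cub; exists y.
  by rewrite bspike_at.
move=> _ [x _ <-]; exists [set g | range h g /\ bspike x (b x) (- M) <= g].
  by move=> g [].
split=> [g []//|c clb]; apply/funAlg_leP => y.
have [->|yx] := pselect (y = x).
  rewrite bspike_at -(funAlg_real (S := boundedClass R T) (b x) x).
  apply/funAlg_leP/clb; split; first by exists (lreal A (b x)); rewrite ?lhom_real.
  apply/funAlg_leP => z; rewrite funAlg_real.
  have [->|zx] := pselect (z = x); first by rewrite bspike_at.
  by rewrite bspike_off.
rewrite bspike_off//; have [a ax ay] := hsep x y (nesym yx).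
(* The coefficient, which is nonnegative, gives [h g] the value [b x] at [x]; since [h a y = 0] the
   value at [y] is [- M], and the square keeps [h g] above [- M] everywhere. *)
pose g := ((b x + M) / (h a x ^+ 2)) *: (a * a) - lreal A M.
have gE z : h g z = (b x + M) / (h a x ^+ 2) * (h a z ^+ 2) - M.
  by rewrite lhomB lhomZ lhomM lhom_real funAlgB funAlgZ funAlgM funAlg_real.
have /funAlg_leP/(_ y) : c <= h g.
  apply: clb; split; first by exists g.
  apply/funAlg_leP => z; rewrite gE; have [->|zx] := pselect (z = x).
    by rewrite bspike_at divfK ?sqrf_eq0// addrK.
  rewrite bspike_off// lerDr mulr_ge0 ?sqr_ge0// divr_ge0 ?sqr_ge0//.
  by rewrite -lerBlDr sub0r.
by rewrite gE ay expr0n/= mulr0 sub0r.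
Qed.

End BoundedFunctions.

(** * Kernel pairs, and injectivity of monomorphisms *)

Section BoundedAlgebra.
Context {R : realType} {A : lAlgebra R}.

Lemma lalg_leD2r (a b c : A) : a <= b -> a + c <= b + c.
Proof. by move=> /asboolP ab; apply/asboolP; exact: lle_add. Qed.

Lemma lalg_scale_ge0 (r : R) (a : A) : 0 <= r -> 0 <= a -> 0 <= r *: a.
Proof. by move=> r0 /asboolP a0; apply/asboolP; exact: lscale_ge0. Qed.

Hypothesis bA : bounded_lalg A.

(* The order axioms alone do not give [0 <= 1]; the bound [-1 <= n] does. *)
Lemma lalg_ge01 : 0 <= 1 :> A.
Proof.
have [n /(@lalg_leD2r _ _ 1)] := bA (- 1).
rewrite addNr -mulrSr => /(@lalg_scale_ge0 n.+1%:R^-1); rewrite invr_ge0.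
by rewrite -(scaler_nat _ (1 : A)) scalerA mulVf ?pnatr_eq0// scale1r; exact.
Qed.

Lemma lalg_le_nat (m n : nat) : (m <= n)%N -> m%:R <= n%:R :> A.
Proof.
move=> /subnK <-; rewrite natrD; have /(@lalg_leD2r _ _ m%:R) : 0 <= (n - m)%:R :> A.
  by rewrite -scaler_nat; apply: lalg_scale_ge0 => //; exact: lalg_ge01.
by rewrite add0r.
Qed.

End BoundedAlgebra.

Section KernelPair.
Context {R : realType} {A B : lAlgebra R} (h : lAlgHom A B).

(** The pullback of [h] along itself: its two projections are equalized by [h], so a monomorphism
    cannot tell them apart. *)
Record kernel_pair := KernelPair {
  kfst : A; ksnd : A; kernel_pairP : h kfst = h ksnd }.

Lemma kernel_pair_eq (u v : kernel_pair) :
  kfst u = kfst v -> ksnd u = ksnd v -> u = v.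
Proof.
case: u v => [a a' ha] [b b' hb] /= ab ab'; subst b b'.
by rewrite (Prop_irrelevance ha hb).
Qed.

Let kzero : kernel_pair := KernelPair (erefl (h 0)).
Let kone : kernel_pair := KernelPair (erefl (h 1)).
Let kopp (u : kernel_pair) : kernel_pair.
Proof.
by refine (@KernelPair (- kfst u) (- ksnd u) _); rewrite !lhomN kernel_pairP.
Defined.
Let kadd (u v : kernel_pair) : kernel_pair.
Proof.
refine (@KernelPair (kfst u + kfst v) (ksnd u + ksnd v) _).
by rewrite !lhomD !kernel_pairP.
Defined.
Let kmul (u v : kernel_pair) : kernel_pair.
Proof.
refine (@KernelPair (kfst u * kfst v) (ksnd u * ksnd v) _).
by rewrite !lhomM !kernel_pairP.
Defined.
Let kscale (r : R) (u : kernel_pair) : kernel_pair.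
Proof.
by refine (@KernelPair (r *: kfst u) (r *: ksnd u) _); rewrite !lhomZ kernel_pairP.
Defined.
Let kmeet (u v : kernel_pair) : kernel_pair.
Proof.
refine (@KernelPair (Order.meet (kfst u) (kfst v)) (Order.meet (ksnd u) (ksnd v)) _).
by rewrite !lhomI !kernel_pairP.
Defined.
Let kjoin (u v : kernel_pair) : kernel_pair.
Proof.
refine (@KernelPair (Order.join (kfst u) (kfst v)) (Order.join (ksnd u) (ksnd v)) _).
by rewrite !lhomU !kernel_pairP.
Defined.

Definition kernel_pair_lAlgebra : lAlgebra R.
Proof.
refine (@LAlgebra R kernel_pair kzero kone kopp kadd kmul kscale
  (fun u v => lle (kfst u) (kfst v) /\ lle (ksnd u) (ksnd v)) kmeet kjoin
  _ _ _ _ _ _ _ _ _ _ _ _ _ _ _ _ _ _ _ _ _ _ _);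
  try (move=> *; apply: kernel_pair_eq).
all: try exact: laddA.
all: try exact: laddC.
all: try exact: ladd0.
all: try exact: laddN.
all: try exact: lmulA.
all: try exact: lmul1l.
all: try exact: lmul1r.
all: try exact: lmulDl.
all: try exact: lmulDr.
all: try exact: lscaleA.
all: try exact: lscale1.
all: try exact: lscaleDr.
all: try exact: lscaleDl.
all: try exact: lscaleAl.
all: try exact: lscaleAr.
- by move=> u; split; exact: lle_refl.
- by apply: lle_anti; tauto.
- by apply: lle_anti; tauto.
- move=> u v w [? ?] [? ?].
  by split; [exact: lle_trans (kfst v) _ _ _|exact: lle_trans (ksnd v) _ _ _].
- move=> u v w; split=> [[/lle_meet[? ?] /lle_meet[? ?]]//|[[? ?] [? ?]]].
  by split; apply/lle_meet.
- move=> u v w; split=> [[/ljoin_le[? ?] /ljoin_le[? ?]]//|[[? ?] [? ?]]].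
  by split; apply/ljoin_le.
- by move=> u v w [? ?]; split; exact: lle_add.
- by move=> u v [? ?] [? ?]; split; exact: lmul_ge0.
- by move=> r u r0 [? ?]; split; exact: lscale_ge0.
Defined.

Local Notation K := kernel_pair_lAlgebra.

Definition kernel_fst : lAlgHom K A.
Proof. by refine (@LAlgHom R K A kfst _ _ _ _ _ _). Defined.

Definition kernel_snd : lAlgHom K A.
Proof. by refine (@LAlgHom R K A ksnd _ _ _ _ _ _). Defined.

Lemma kernel_pair_leP (u v : K) :
  kernel_fst u <= kernel_fst v -> kernel_snd u <= kernel_snd v -> u <= v.
Proof. by move=> /asboolP ? /asboolP ?; apply/asboolP. Qed.

(** [bal_monomorphism] tests only against objects of [bal], so the kernel pair has to be one; both
    properties hold componentwise. *)
Lemma kernel_pair_bal : bal A -> bal K.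
Proof.
move=> [bA archA]; split=> [u|u v uv].
  have [m um] := bA (kernel_fst u); have [n un] := bA (kernel_snd u).
  exists (m + n)%N; apply: kernel_pair_leP; rewrite lhomMn lhom1.
    by apply: le_trans um _; exact: lalg_le_nat (leq_addr _ _).
  by apply: le_trans un _; exact: lalg_le_nat (leq_addl _ _).
apply: kernel_pair_leP; rewrite lhom0.
  by apply: (archA _ (kernel_fst v)) => n; rewrite -lhomMn; exact/lhom_le/uv.
by apply: (archA _ (kernel_snd v)) => n; rewrite -lhomMn; exact/lhom_le/uv.
Qed.

(** The two projections of the kernel pair agree after [h], hence are equal; evaluate them at the
    pair formed by [a] and [b]. *)
Lemma monomorphism_injective : bal A -> bal_monomorphism h -> injective h.
Proof.
move=> balA hmono a b hab.
exact: (hmono K (kernel_pair_bal balA) kernel_fst kernel_snd kernel_pairP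
         (KernelPair hab)).
Qed.

End KernelPair.

(** * The isolated maximal ideals of B(T) are the points of T *)

Section MaximalIdeals.
Context {R : realType} {T : Type}.
Local Notation B := (Balg R T).

Definition point_ideal (x : T) : set B := vanish (lid B) [set x].

Lemma point_idealP x (f : B) : point_ideal x f <-> f x = 0.
Proof. exact: (vanish1P (lid B)). Qed.

Lemma point_ideal_inj : injective point_ideal.
Proof.
move=> x y xy; apply: contrapT => nxy.
have : point_ideal y (bspike x 1 0).
  by apply/point_idealP; rewrite bspike_off//; exact: nesym.
rewrite -xy => /point_idealP; rewrite bspike_at => /eqP.
by rewrite oner_eq0.
Qed.

Lemma maximal_lideal_sub (A : lAlgebra R) (M N : set A) :
  maximal_lideal M -> maximal_lideal N -> M `<=` N -> M = N.
Proof.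
move=> [_ _ Mmax] [Nid NT _] MN.
by case: (Mmax N Nid MN) => // /NT.
Qed.

(** The ideal of functions supported at [x] lies in every maximal ideal except [point_ideal x], so
    it cuts out the complement of that point. *)
Lemma point_ideal_isolated x : Xset (point_ideal x).
Proof.
have maxx : Yset (point_ideal x) by exact: vanish1_maximal.
split=> //; split=> [_ ->//|].
exists (vanish (lid B) (~` [set x])); first exact: vanish_lideal.
apply/seteqP; split=> M.
  move=> [maxM Mx]; split=> // f fx.
  have [g Mg gx] : exists2 g, M g & g x <> 0.
    apply: contrapT => nex; apply: Mx.
    apply: maximal_lideal_sub => // g Mg; apply/point_idealP.
    by apply: contrapT => gx; apply: nex; exists g.
  have [Mid _ _] := maxM; have [_ _ MM _] := Mid.
  (* [g] is in [M] and nonzero at [x], so every function supported at [x] is a multiple of [g] and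
     belongs to [M]. *)
  have -> : f = (f x / g x) *: (g * bspike x 1 0).
    apply: funInP => y; rewrite funAlgZ funAlgM.
    have [->|yx] := pselect (y = x).
      by rewrite bspike_at mulr1 divfK//; exact/eqP.
    by rewrite bspike_off// !mulr0; exact: fx.
  by apply: lideal_scale => //; case: (MM (bspike x 1 0) _ Mg).
move=> [maxM sM]; split=> // Mx.
have /sM : vanish (lid B) (~` [set x]) (bspike x 1 0).
  by move=> y yx; exact: bspike_off.
by rewrite Mx => /point_idealP; rewrite bspike_at => /eqP; rewrite oner_eq0.
Qed.

(** For isolated [M], some ideal [I] lies in exactly the maximal ideals other than [M]. A function
    in [I] outside [M] is nonzero at some [x], so [point_ideal x] does not contain [I] and must be
    [M]. *)
Lemma XsetE : Xset (A := B) = range point_ideal.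
Proof.
apply/seteqP; split=> [M|_ [x _ <-]]; last exact: point_ideal_isolated.
move=> [maxM [_ [I _ MI]]].
have nIM : ~ I `<=` M.
  move=> IM; have : [set M | Yset M /\ I `<=` M] M by [].
  by rewrite -MI => -[_]; apply.
move: nIM => /existsNP[f /not_implyP[If nMf]].
have [x fx] : exists x, f x <> 0.
  apply: contrapT => /forallNP f0; apply: nMf.
  have [[M0 _ _ _] _ _] := maxM.
  rewrite (_ : f = 0)//; apply: funInP => x; exact: contrapT (f0 x).
exists x => //; apply: contrapT => xM.
have : ([set M | Yset M /\ I `<=` M]) (point_ideal x).
  by rewrite -MI; split=> //; exact: vanish1_maximal.
by move=> [_ /(_ _ If)] /point_idealP.
Qed.

End MaximalIdeals.

(** * The topology induced by a homomorphism into B(T) *)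

Section InducedTopology.
Context {R : realType} {T : Type}.
Local Notation B := (Balg R T).

Definition cozero_union (A : lAlgebra R) (h : lAlgHom A B) (E : set A) : set T :=
  [set x | exists2 a, E a & h a x <> 0].

(** [flat_map h] sends the point [x] to [vanish h [set x]], so the open set of maximal ideals not
    containing [I] pulls back to the points where some member of [I] is nonzero. *)
Lemma tauE (A : lAlgebra R) (h : lAlgHom A B) :
  tau h = [set point_ideal (R := R) @` U | U in range (cozero_union h)].
Proof.
have flatE x : flat_map h (point_ideal x) = vanish h [set x] by [].
apply/seteqP; split=> [_ [V [VY [I Iid VI]] ->]|_ [_ [E _ <-] <-]].
  have VP M : Yset M -> V M <-> ~ I `<=` M.
    move=> maxM; split=> [VM IM|nIM].
      have : [set M | Yset M /\ I `<=` M] M by [].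
      by rewrite -VI => -[].
    apply: contrapT => nVM; apply: nIM.
    by have : (@Yset _ A `\` V) M by []; rewrite VI => -[].
  have maxv x : Yset (vanish h [set x]) by exact: vanish1_maximal.
  exists (cozero_union h I); first by exists I.
  rewrite XsetE; apply/seteqP; split=> [_ [x [a Ia ax] <-]|_ [[x _ <-] /= Vx]].
    split; first by exists x.
    by rewrite /preimage/= flatE; apply/(VP _ (maxv x)) => /(_ _ Ia) /vanish1P.
  exists x => //; move: Vx; rewrite flatE => /(VP _ (maxv x)).
  move=> /existsNP[a /not_implyP[Ia vna]]; exists a => // ax.
  by apply: vna; apply/vanish1P.
(* [E] need not be an ideal; all elements vanishing off its cozero union form one with the same
   cozero union. *)
pose I := vanish h (~` cozero_union h E).
have Iid : lideal I by exact: vanish_lideal.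
exists [set M | Yset M /\ ~ I `<=` M].
  split=> [M []//|]; exists I => //.
  apply/seteqP; split=> M [maxM].
    by move=> /not_andP[//|/contrapT].
  by move=> IM; split=> // -[].
rewrite XsetE; apply/seteqP; split=> [_ [x [a Ea ax] <-]|_ [[x _ <-] [_ nI]]].
  split; first by exists x.
  split; first exact: vanish1_maximal.
  move=> /(_ a) aI; apply: ax; apply/vanish1P; apply: aI => y nEy.
  by apply: contrapT => ay; apply: nEy; exists a.
exists x => //; apply: contrapT => nEx; apply: nI.
by rewrite flatE => a Ia; apply/vanish1P/Ia.
Qed.

(** Since [point_ideal] is injective, the comparison of topologies on the isolated points can be
    made on [T]. *)
Lemma compatibleP (A C : lAlgebra R) (h : lAlgHom A B) (k : lAlgHom C B) :
  compatible h k <-> range (cozero_union h) = range (cozero_union k).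
Proof.
rewrite /compatible !tauE; split=> [hk|->//].
have img_inj : injective (fun U : set T => point_ideal (R := R) @` U).
  move=> U V UV; apply/funext => x.
  by rewrite -(image_inj (A := U) (point_ideal_inj (R := R))) UV image_inj//;
    exact: point_ideal_inj.
by apply/funext => U; rewrite -(image_inj (A := range _) img_inj) hk image_inj.
Qed.

End InducedTopology.

(** * The norm as a supremum norm; uniformly closed images *)

Section UniformNorm.
Context {R : realType} {T : Type} {A : lAlgebra R}.
Variables (h : lAlgHom A (Balg R T)) (hI : injective h).

Lemma labs_leP a (r : R) : labs a <= lreal A r <-> forall x, `|h a x| <= r.
Proof.
rewrite -(lhom_inj_le _ _ hI) lhom_abs lhom_real; split=> [/funAlg_leP ar x|ar].
  by have := ar x; rewrite funAlg_abs funAlg_real.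
by apply/funAlg_leP => x; rewrite funAlg_abs funAlg_real.
Qed.

(** The point [t] bounds the set of admissible [r] below; over an empty [T] every real is admissible
    and the infimum is not a genuine one. *)
Lemma lnorm_le (t : T) a r : (forall x, `|h a x| <= r) -> lnorm a <= r.
Proof.
move=> ar; apply: ge_inf; last exact/labs_leP.
by exists 0 => s /labs_leP/(_ t); exact: le_trans.
Qed.

Lemma le_lnorm a x : `|h a x| <= lnorm a.
Proof.
apply: lb_le_inf; last by move=> r /labs_leP.
by have [M aM] := Balg_bounded (h a); exists M; apply/labs_leP.
Qed.

(** Approximants within [n.+1%:R^-1] of [f] form a Cauchy sequence for [lnorm]; as [lnorm] dominates
    each pointwise value, [h] sends its limit to [f]. *)
Lemma uniformly_complete_closed (f : Balg R T) : uniformly_complete A ->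
  (forall eps : R, 0 < eps -> exists a, forall x, `|h a x - f x| <= eps) ->
  exists a, h a = f.
Proof.
move=> ucA happ.
have [[t]|nT] := pselect (inhabited T); last first.
  by exists 0; apply: funInP => x; case: nT.
have /choice[u uP] n : exists a, forall x, `|h a x - f x| <= n.+1%:R^-1.
  by apply: happ; rewrite invr_gt0 ltr0n.
have small eps : 0 < eps -> exists N, forall n, (N <= n)%N -> n.+1%:R^-1 < eps :> R.
  move=> eps0; exists (Num.truncn eps^-1) => n Nn.
  rewrite invf_plt ?posrE ?ltr0n//; apply: lt_le_trans (truncnS_gt _) _.
  by rewrite ler_nat.
have [|a ua] := ucA u.
  move=> eps eps0; have [|N Nsmall] := small (eps / 3); first by rewrite divr_gt0.
  exists N => m n Nm Nn; apply: (@le_lt_trans _ _ (eps / 3 + eps / 3)); last lra.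
  apply: (lnorm_le t) => x; rewrite lhomB funAlgB.
  rewrite (_ : _ - _ = (h (u m) x - f x) - (h (u n) x - f x)); last by ring.
  apply: le_trans (ler_normB _ _) _; apply: lerD.
    exact: le_trans (uP m x) (ltW (Nsmall m Nm)).
  exact: le_trans (uP n x) (ltW (Nsmall n Nn)).
exists a; apply: funInP => x; apply/eqP; rewrite -subr_eq0 -normr_le0.
apply/ler_addgt0Pr => eps eps0; rewrite add0r.
have e20 : 0 < eps / 2 by rewrite divr_gt0.
have [N Nsmall] := small _ e20.
move/cvgrPdist_lt : ua => /(_ _ e20)[M _ Msmall].
pose n := maxn N M.
have un : lnorm (u n - a) < eps / 2.
  have /= := Msmall n (leq_maxr N M); rewrite sub0r normrN.
  exact: le_lt_trans (ler_norm _).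
rewrite (_ : _ - _ = (h (u n) x - f x) - (h (u n - a) x)); last first.
  by rewrite lhomB funAlgB; ring.
apply: le_trans (ler_normB _ _) _; rewrite (splitr eps); apply: lerD.
  by apply: le_trans (uP n x) (ltW (Nsmall n _)); exact: leq_maxl.
by apply: le_trans (ltW un); exact: le_lnorm.
Qed.

End UniformNorm.

(** * Compactness for directed and for finite covers *)

Section Compactness.
Context {T : topologicalType}.

(** Near-covering compactness is applied to the filter of tails of the directed index set, so a
    single index suffices. *)
Lemma compact_directed_cover (I : Type) (D : set I) (U : I -> set T) (K : set T) :
  compact K -> D !=set0 ->
  (forall i j, D i -> D j -> exists2 k, D k & U i `|` U j `<=` U k) ->
  (forall x, K x -> exists2 i, D i & nbhs x (U i)) ->
  exists2 k, D k & K `<=` U k.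
Proof.
move=> cK [i0 Di0] dirU covU.
pose F : set_system I := filter_from D (fun i => [set k | D k /\ U i `<=` U k]).
have FF : Filter F.
  apply: filter_from_filter; first by exists i0.
  move=> i j Di Dj; have [k Dk Uk] := dirU i j Di Dj; exists k => //.
  by move=> l [Dl kl]; split; split=> // x Ux; apply/kl/Uk; [left|right].
move/compact_near_coveringP : cK => /(_ I F (fun i x => U i x) FF) covK.
have [|i Di iP] := covK.
  move=> x Kx; have [i Di Ui] := covU x Kx.
  exists (U i, [set k | D k /\ U i `<=` U k]) => /=.
    by split=> //; exists i.
  by move=> [y k] [/= Uiy [_ ik]]; exact: (ik _ Uiy).
by exists i => //; apply: (iP i); split.
Qed.

(** The finite subfamilies are directed under union. *)
Lemma compact_finite_cover (I : Type) (D : set I) (U : I -> set T) (K : set T) :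
  compact K -> (forall x, K x -> exists2 i, D i & nbhs x (U i)) ->
  exists D', [/\ finite_set D', D' `<=` D & K `<=` \bigcup_(i in D') U i].
Proof.
move=> cK covU.
have [|||D' [finD' D'D]] := @compact_directed_cover _
    [set D' | finite_set D' /\ D' `<=` D] (fun D' => \bigcup_(i in D') U i) K cK.
- by exists set0; split; [exact: finite_set0|exact: sub0set].
- move=> D1 D2 [fin1 D1D] [fin2 D2D]; exists (D1 `|` D2).
    by split; [rewrite finite_setU|move=> i []; [exact: D1D|exact: D2D]].
  by move=> x [] [i Di Ui]; exists i => //; [left|right].
- move=> x /covU[i Di Ui]; exists [set i].
    by split=> [|_ ->]; [exact: finite_set1|].
  by rewrite bigcup_set1.
by exists D'.
Qed.

End Compactness.

(** * Urysohn functions on a compact Hausdorff space *)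

Section Urysohn.
Context {Y : topologicalType}.
Hypotheses (cY : compact [set: Y]) (hY : hausdorff_space Y).

Lemma compact_hausdorff_separation (R : realType) (y : Y) (U : set Y) :
  open U -> U y ->
  exists f : Calg R Y, [/\ f y = 1, forall z, ~ U z -> f z = 0 &
                        forall z, 0 <= f z <= 1].
Proof.
move=> oU Uy.
have crY : completely_regular_space Y.
  apply: (@normal_completely_regular R); first exact: compact_normal.
  exact: hausdorff_accessible.
have [||f [cf f01 f0 f1]] := (uniform_separatorP (R := R) _ _).1 (crY y (~` U) _ _).
- exact: open_closedC.
- by move=> /(_ Uy).
pose g : Calg R Y := FunIn (cf : funset (continuousClass R Y) f).
exists (1 - g); split.
- by rewrite funAlgB funAlg1 (_ : g y = 0) ?subr0//; apply: f0; exists y.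
- move=> z nUz; rewrite funAlgB funAlg1 (_ : g z = 1) ?subrr//.
  by apply: f1; exists z.
- move=> z; rewrite funAlgB funAlg1.
  have /f01 : range f (g z) by exists z.
  by rewrite /= in_itv/= => /andP[? ?]; rewrite subr_ge0 lerBlDr lerDl; apply/andP.
Qed.

Lemma compact_hausdorff_bump (R : realType) (p x : Y) : p <> x ->
  exists f : Calg R Y, [/\ f x = 1, nbhs p [set z | f z = 0] &
                        forall z, 0 <= f z <= 1].
Proof.
move=> px.
have op : open (~` [set p]).
  exact/closed_openC/accessible_closed_set1/hausdorff_accessible.
have [f [fx fp f01]] := compact_hausdorff_separation R op (nesym px).
have cf : continuous f := funvalP (f : funIn _).
(* The function [max 0 (2 f - 1)] keeps the value 1 at [x] but vanishes wherever [f] is at most 1/2,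
   hence on a whole neighbourhood of [p]. *)
pose g : Calg R Y := Order.join (0 : Calg R Y) (f + f - 1 : Calg R Y).
have gE z : g z = Num.max 0 (f z + f z - 1).
  by rewrite funAlgU funAlgB funAlgD funAlg1 funAlg0.
exists g; split.
- by rewrite gE fx addrK; exact/max_idPr.
- have fp0 : f p = 0 by apply: fp; apply.
  have : nbhs p (f @^-1` [set r : R | r < 1/2]).
    by apply: cf; rewrite fp0; apply: lt_nbhsl; lra.
  apply: filterS => z fz; have {}fz : f z < 1 / 2 := fz.
  by change (g z = 0); rewrite gE; apply/max_idPl; lra.
- move=> z; rewrite gE le_max lexx/= ge_max ler01/=.
  by have /andP[_ ?] := f01 z; lra.
Qed.

End Urysohn.

(** * Algebras of continuous functions separating points from closed sets *)

Section ContinuousSeparation.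
Context {R : realType} {X : topologicalType} {A : lAlgebra R}.
Variable h : lAlgHom A (Balg R X).
Hypothesis hcont : forall a, continuous (h a : X -> R).
Hypothesis hsep : forall (U : set X) x, open U -> U x ->
  exists2 a, h a x <> 0 & forall z, ~ U z -> h a z = 0.

(** Continuity makes cozero sets open, and [hsep] makes every open set a union of them; so any two
    such algebras are compatible. *)
Lemma cozero_union_open : range (cozero_union h) = open.
Proof.
apply/seteqP; split=> [_ [E _ <-]|U oU].
  rewrite (_ : cozero_union h E =
      \bigcup_(a in E) (h a : X -> R) @^-1` [set r | r != 0]).
    apply: bigcup_open => a _; apply: open_comp; last exact: open_neq.
    by move=> x _; exact: hcont.
  by apply/seteqP; split=> x [a Ea] /eqP ax; exists a => //; exact/eqP.
exists [set a | forall z, ~ U z -> h a z = 0] => //.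
apply/seteqP; split=> x.
  by move=> [a aU ax]; apply: contrapT => /aU.
by move=> Ux; have [a ax aU] := hsep oU Ux; exists a.
Qed.

Lemma continuous_basic_extension : hausdorff_space X -> injective h ->
  basic_extension h.
Proof.
move=> hX hI; apply: separating_basic_extension => // x y xy.
have oy : open (~` [set y]).
  exact/closed_openC/accessible_closed_set1/hausdorff_accessible.
have [a ax ay] := hsep oy xy.
by exists a; [exact/eqP|apply: ay; apply].
Qed.

End ContinuousSeparation.

Section Composition.
Context {R : realType} {A B C : lAlgebra R}.

Definition lcomp (g : lAlgHom B C) (f : lAlgHom A B) : lAlgHom A C.
Proof.
refine (@LAlgHom R A C (g \o f) _ _ _ _ _ _) => * /=.
- by rewrite !lhomD.
- by rewrite !lhomZ.
- by rewrite !lhomM.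
- by rewrite !lhom1.
- by rewrite !lhomI.
- by rewrite !lhomU.
Defined.

End Composition.

Lemma dense_image_eq (R : realType) (X Y : topologicalType) (e : X -> Y)
    (f g : Y -> R) :
  dense (range e) -> continuous f -> continuous g -> f \o e =1 g \o e -> f =1 g.
Proof.
move=> de cf cg feg y; apply: contrapT => /eqP fgy.
have cfg : continuous (fun y => f y - g y) by move=> z; exact: cvgB (cf z) (cg z).
have ofg : open [set y | f y - g y != 0].
  by apply: (open_comp (f := fun y => f y - g y) (D := [set r | r != 0]));
    [move=> z _; exact: cfg|exact: open_neq].
have [|z [/= fgx [x _ ex]]] := de _ _ ofg; first by exists y; rewrite /= subr_eq0.
by move: fgx; rewrite -ex subr_eq0 => /eqP; apply; exact: feg.
Qed.

(** * Continuous functions that identify two points *)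

Section PairAlgebra.
Variables (R : realType) (Y : topologicalType) (p q : Y).

Let C : set (Y -> R) := [set f | continuous f /\ f p = f q].
Local Notation CY := (continuousClass R Y).

Let C_cst c : C (fun=> c). Proof. by split=> //; exact: (funset_cst CY). Qed.
Let C_add f g : C f -> C g -> C (fun y => f y + g y).
Proof.
move=> [cf fpq] [cg gpq].
by split; [exact: (@funset_add _ _ CY)|rewrite fpq gpq].
Qed.
Let C_mul f g : C f -> C g -> C (fun y => f y * g y).
Proof.
move=> [cf fpq] [cg gpq].
by split; [exact: (@funset_mul _ _ CY)|rewrite fpq gpq].
Qed.
Let C_min f g : C f -> C g -> C (fun y => Num.min (f y) (g y)).
Proof.
move=> [cf fpq] [cg gpq].
by split; [exact: (@funset_min _ _ CY)|rewrite fpq gpq].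
Qed.
Let C_max f g : C f -> C g -> C (fun y => Num.max (f y) (g y)).
Proof.
move=> [cf fpq] [cg gpq].
by split; [exact: (@funset_max _ _ CY)|rewrite fpq gpq].
Qed.

Definition pairAlg : lAlgebra R :=
  funAlgebra (FunClass C_cst C_add C_mul C_min C_max).

Definition pair_fun (f : Calg R Y) (fpq : f p = f q) : pairAlg :=
  FunIn (conj (funvalP (f : funIn _)) fpq :
    funset (FunClass C_cst C_add C_mul C_min C_max) f).

Definition pair_incl : lAlgHom pairAlg (Calg R Y).
Proof.
by refine (@LAlgHom R pairAlg (Calg R Y)
  (fun f => FunIn (proj1 (funvalP (f : funIn _)) : funset (continuousClass R Y) f))
  _ _ _ _ _ _) => *; apply: funInP.
Defined.

Lemma pair_incl_inj : injective pair_incl.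
Proof.
move=> f g fg; apply: funInP => y.
by move: fg => /(congr1 (fun f : Calg R Y => f y)).
Qed.

Hypotheses (cY : compact [set: Y]) (hY : hausdorff_space Y).

(** Regarding [Y] as its own compactification embeds C(Y) in B(Y), where the norm is the supremum
    norm. *)
Lemma compactification_id : compactification (@id Y).
Proof.
have rT : range (@id Y) = setT by rewrite image_id.
split=> //; last by rewrite rT => O [y Oy] _; exists y.
split=> [x y //|x|U oU]; [exact: cvg_id|exists U => //].
by rewrite image_id rT setIT.
Qed.

Lemma eflat_id_inj : injective (eflat R compactification_id).
Proof.
move=> f g fg; apply: funInP => y.
by move: fg => /(congr1 (fun f : Balg R Y => f y)).
Qed.

(** A uniform limit of continuous functions is continuous, and the equation between the values at
    [p] and [q] survives pointwise limits. *)
Lemma pairAlg_ubal : ubal pairAlg.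
Proof.
pose h := lcomp (eflat R compactification_id) pair_incl.
have hI : injective h by apply: inj_comp; [exact: eflat_id_inj|exact: pair_incl_inj].
have hE f y : h f y = f y by [].
split; first exact: inj_bal hI.
move=> u uC.
have unif eps : 0 < eps -> exists N, forall m n y, (N <= m)%N -> (N <= n)%N ->
    `|u m y - u n y| < eps.
  move=> /uC[N uN]; exists N => m n y Nm Nn.
  apply: le_lt_trans (uN m n Nm Nn); rewrite -!hE -funAlgB -lhomB.
  exact: le_lnorm.
have ucvg y : cvg ((fun n => u n y) @ \oo).
  apply: cauchy_cvg; apply: cauchy_exP => eps eps0.
  have [N uN] := unif _ eps0; exists (u N y).
  by exists N => // n /= Nn; exact: uN.
pose g y := lim ((fun n => u n y) @ \oo).
have ug eps : 0 < eps -> exists N, forall n y, (N <= n)%N -> `|u n y - g y| <= eps.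
  move=> eps0; have [N uN] := unif _ eps0; exists N => n y Nn.
  rewrite distrC.
  have cu : (fun m => `|u m y - u n y|) @ \oo --> `|g y - u n y|.
    by apply: cvg_norm; apply: cvgB; [exact: ucvg|exact: cvg_cst].
  rewrite -(cvg_lim _ cu)//; apply: limr_le.
    by apply/cvg_ex; eexists; exact: cu.
  by exists N => // m /= Nm; rewrite ltW// uN.
have gC : C g.
  split; last first.
    by rewrite /g (_ : (fun n => u n p) = (fun n => u n q))//; apply/funext => n;
      case: (funvalP (u n : funIn _)).
  move=> y; apply/cvgrPdist_le => eps eps0.
  have e30 : 0 < eps / 3 by rewrite divr_gt0.
  have [N uN] := ug _ e30.
  have [cu _] := funvalP (u N : funIn _).
  have /cvgrPdist_le/(_ _ e30) := cu y; apply: filterS => z yz.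
  have -> : g y - g z = (u N z - g z) - (u N y - g y) + (u N y - u N z) by ring.
  apply: le_trans (ler_normD _ _) _; have := ler_normB (u N z - g z) (u N y - g y).
  by have := uN N y (leqnn N); have := uN N z (leqnn N); move: yz; lra.
pose a : pairAlg := FunIn (gC : funset (FunClass C_cst C_add C_mul C_min C_max) g).
exists a; apply/cvgrPdist_le => eps eps0.
have [N uN] := ug _ eps0; exists N => // n /= Nn.
rewrite sub0r normrN.
have nle : lnorm (u n - a) <= eps.
  by apply: (lnorm_le hI p) => y; rewrite hE funAlgB; exact: uN.
rewrite ger0_norm//; apply: le_trans (normr_ge0 (h (u n - a) p)) _.
exact: le_lnorm.
Qed.

End PairAlgebra.

(** * The extension [eflat] and the points outside e[X] *)

Section Compactification.
Context {R : realType} {X Y : topologicalType} {e : X -> Y}.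
Variable ce : compactification e.
Local Notation alpha := (eflat R ce).

Let cY : compact [set: Y]. Proof. by case: ce. Qed.
Let hY : hausdorff_space Y. Proof. by case: ce. Qed.
Let einj : injective e. Proof. by case: ce => _ _ []. Qed.
Let econt : continuous e. Proof. by case: ce => _ _ []. Qed.
Let eopen : forall U, open U -> exists2 V, open V & e @` U = V `&` range e.
Proof. by case: ce => _ _ []. Qed.
Let edense : dense (range e). Proof. by case: ce. Qed.

Lemma Calg_continuous (f : Calg R Y) : continuous (f : Y -> R).
Proof. exact: (funvalP (f : funIn _)). Qed.

Lemma eflatE (f : Calg R Y) x : alpha f x = f (e x). Proof. by []. Qed.

Lemma eflat_continuous (f : Calg R Y) : continuous (alpha f : X -> R).
Proof. move=> x; apply: (@continuous_comp _ _ _ e (f : Y -> R)).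
  exact: econt.
exact: Calg_continuous. Qed.

Lemma eflat_inj : injective alpha.
Proof.
move=> f g fg; apply: funInP.
have feg : (f : Y -> R) \o e =1 (g : Y -> R) \o e.
  by move=> x; move: fg => /(congr1 (fun f : Balg R X => f x)).
exact: dense_image_eq edense (@Calg_continuous f) (@Calg_continuous g) feg.
Qed.

Lemma compactification_nbhs (U : set X) x : open U -> U x ->
  exists V : set Y, [/\ open V, V (e x) & forall z, V (e z) -> U z].
Proof.
move=> oU Ux; have [V oV eUV] := eopen oU; exists V; split=> //.
  have : (e @` U) (e x) by exists x.
  by rewrite eUV => -[].
move=> z Vz; have : (V `&` range e) (e z) by split=> //; exists z.
by rewrite -eUV => -[z' Uz' /einj <-].
Qed.

(** The extra closed set [P] outside e[X] serves to produce separating functions in smaller algebras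
    than C(Y). *)
Lemma compactification_separation (P : set Y) (U : set X) x :
  closed P -> (forall x, ~ P (e x)) -> open U -> U x ->
  exists f : Calg R Y, [/\ f (e x) = 1, forall z, ~ U z -> f (e z) = 0 &
    forall y, P y -> f y = 0].
Proof.
move=> clP Pe oU Ux; have [V [oV Vx VU]] := compactification_nbhs oU Ux.
have [||f [fx f0 _]] := @compact_hausdorff_separation Y cY hY R (e x) (V `\` P).
- by apply: openI => //; exact: closed_openC.
- by split=> //; exact: Pe.
exists f; split=> [//|z nUz|y Py]; apply: f0 => -[//].
by move=> /VU.
Qed.

Lemma eflat_separation (U : set X) x : open U -> U x ->
  exists2 f : Calg R Y, alpha f x <> 0 & forall z, ~ U z -> alpha f z = 0.
Proof.
move=> oU Ux.
have [f [fx f0 _]] := compactification_separation closed0 (fun _ => id) oU Ux.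
by exists f => //; rewrite eflatE fx; apply/eqP; exact: oner_neq0.
Qed.

Lemma eflat_basic_extension : hausdorff_space X -> basic_extension alpha.
Proof.
move=> hX; apply: continuous_basic_extension => //; first exact: eflat_separation.
exact: eflat_inj.
Qed.

(** A filter on the preimage, pushed forward, clusters at a point [e x] of [K]; as [e] is an
    embedding, the filter clusters at [x]. *)
Lemma embedding_compact_preimage (K : set Y) :
  compact K -> K `<=` range e -> compact (e @^-1` K).
Proof.
move=> cK Ke F FF FK.
have [y [Ky cly]] := cK (e @ F) _ FK.
have [x _ exy] := Ke _ Ky; subst y; exists x; split=> // A B FA.
rewrite nbhsE => -[U [oU Ux] UB].
have [V [oV Vx VU]] := compactification_nbhs oU Ux.
have [y [[a Aa ay] Va]] : (e @` A) `&` V !=set0.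
  apply: cly; last exact: open_nbhs_nbhs.
  by apply: (@filterS _ F _ A) => // a Aa; exists a.
by exists a; split=> //; apply/UB/VU; rewrite ay.
Qed.

Lemma noncompact_remainder : ~ compact [set: X] -> exists p, ~ range e p.
Proof.
move=> ncX; apply: contrapT => /forallNP ep; apply: ncX.
rewrite -(preimage_setT e); apply: embedding_compact_preimage => // y _.
exact: contrapT (ep y).
Qed.

Lemma noncompact_point : ~ compact [set: X] -> inhabited X.
Proof.
move=> ncX; apply: contrapT => nX; apply: ncX.
rewrite (_ : [set: X] = set0); first exact: compact0.
by apply/seteqP; split=> // x _; exact: nX (inhabits x).
Qed.

(* Two distinct points [p], [q] of the remainder could be identified: the
   functions of [C(Y)] with equal values at [p] and [q] form a smaller compatible
   basic extension. *)
Lemma minimal_remainder : hausdorff_space X -> ~ compact [set: X] ->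
  minimal_extension alpha -> exists p, range e = ~` [set p].
Proof.
move=> hX ncX [_ amin]; have [p pe] := noncompact_remainder ncX.
exists p; apply/seteqP; split=> [_ [x _ <-] /= xp|q qp].
  by apply: pe; exists x.
apply: contrapT => qe.
pose gamma := lcomp alpha (pair_incl R p q).
have gcont a : continuous (gamma a : X -> R) by exact: eflat_continuous.
have gsep (U : set X) x : open U -> U x ->
    exists2 a, gamma a x <> 0 & forall z, ~ U z -> gamma a z = 0.
  move=> oU Ux.
  (* Functions vanishing at both [p] and [q] lie in the pair algebra and already separate points of
     [X] from closed sets. *)
  have clpq : closed [set p; q].
    by apply: closedU; apply/accessible_closed_set1/hausdorff_accessible.
  have pqe z : ~ [set p; q] (e z).
    by move=> [zp|zq]; [apply: pe; exists z|apply: qe; exists z].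
  have [f [fx f0 fpq]] := compactification_separation clpq pqe oU Ux.
  have fpqE : f p = f q by rewrite !fpq//; [right|left].
  exists (pair_fun fpqE).
    by rewrite /= fx; apply/eqP; exact: oner_neq0.
  by move=> z /f0.
have gI : injective gamma.
  by apply: inj_comp; [exact: eflat_inj|exact: pair_incl_inj].
have [||delta deltaP] := amin _ gamma (pairAlg_ubal R p q cY hY).
- exact: continuous_basic_extension.
- apply/compatibleP; rewrite !cozero_union_open//.
    exact: eflat_continuous.
  exact: eflat_separation.
(* A function with values 0 at [p] and 1 at [q] would be recovered from its image under [delta],
   which has equal values at both. *)
have op : open (~` [set p]).
  exact/closed_openC/accessible_closed_set1/hausdorff_accessible.
have [f [fq fp _]] := compact_hausdorff_separation cY hY R op qp.
have fpq : pair_incl R p q (delta f) = f by apply: eflat_inj; exact: deltaP.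
have : f p = f q by rewrite -fpq; case: (funvalP (delta f : funIn _)).
rewrite fq fp; first by move=> /eqP; rewrite eq_sym oner_eq0.
by apply.
Qed.

End Compactification.

(** * One missing point means the one-point compactification *)

Section OnePoint.
Context {X Y : topologicalType} {e : X -> Y}.
Variable ce : compactification e.

Lemma one_point_remainder :
  equivalent_compactifications e (Some : X -> one_point_compactification X) ->
  exists p, range e = ~` [set p].
Proof.
move=> [f [g [_ _ fK gK fe]]]; exists (f None); apply/seteqP; split.
  by move=> _ [x _ <-]; rewrite -fe /= => /(can_inj fK).
move=> y yp; case gy: (g y) => [x|]; first by exists x => //; rewrite -fe /= -gy gK.
by case: yp; rewrite /= -gy gK.
Qed.

Variable p : Y.
Hypothesis eE : range e = ~` [set p].

Let cY : compact [set: Y]. Proof. by case: ce. Qed.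
Let hY : hausdorff_space Y. Proof. by case: ce. Qed.
Let einj : injective e. Proof. by case: ce => _ _ []. Qed.
Let econt : continuous e. Proof. by case: ce => _ _ []. Qed.

Let ep x : e x <> p.
Proof. by have : range e (e x) by [exists x]; rewrite eE. Qed.

Let closed_preimage (K : set Y) : closed K -> ~ K p ->
  compact (e @^-1` K) /\ closed (e @^-1` K).
Proof.
move=> clK Kp; split; last by apply: closed_comp => // x _; exact: econt.
apply: (embedding_compact_preimage ce).
  exact: subclosed_compact clK cY _.
by move=> y Ky; rewrite eE => yp; apply: Kp; rewrite -yp.
Qed.

(** Where a bump at [e x] vanishing near [p] is at least 1/2, there is a closed neighbourhood of
    [e x] missing [p]; its preimage is compact. *)
Lemma remainder_locally_compact (R : realType) : locally_compact [set: X].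
Proof.
move=> x _.
have [f [fx fp _]] := compact_hausdorff_bump cY hY R (nesym (@ep x)).
have cf := @Calg_continuous R Y f.
exists (e @^-1` [set y | 1 / 2 <= f y]).
  suff : nbhs x (e @^-1` [set y | 1 / 2 <= f y]) by apply: filterS.
  apply: econt.
  have : nbhs (e x) ((f : Y -> R) @^-1` [set r | 1 / 2 < r]).
    by apply: cf; rewrite fx; apply: lt_nbhsr; lra.
  by apply: filterS => y /ltW.
apply: closed_preimage.
  exact: (continuous_closedP (f : Y -> R)).1 cf _ (@closed_ge R (1 / 2)).
by rewrite /= (_ : f p = 0) ?(nbhs_singleton fp)//; lra.
Qed.

(** Sending [None] to [p] extends [e] to a bijection. It is continuous at [None] because closed sets
    missing [p] have closed compact preimages, and its inverse is continuous because it goes from a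
    compact space to a Hausdorff one. *)
Lemma remainder_one_point :
  equivalent_compactifications e (Some : X -> one_point_compactification X).
Proof.
pose f (o : one_point_compactification X) := if o is Some x then e x else p.
have fI : injective f.
  by move=> [x|] [y|] //=; [move=> /einj ->|move=> /ep|move=> /esym/ep].
have /choice[g gK] y : exists o, f o = y.
  have [->|yp] := pselect (y = p); first by exists None.
  have : range e y by rewrite eE.
  by move=> [x _ <-]; exists (Some x).
have fc : continuous f.
  move=> [x|] V; first by move=> /econt.
  rewrite /= nbhsE => -[W [oW Wp] WV].
  have [|cK clK] := @closed_preimage (~` W) (open_closedC oW); first by apply.
  exists (e @^-1` (~` W)) => // o [[x /contrapT Wx <-]| ->]; exact: WV.
exists f, g; split=> //; last by move=> o; exact: fI.
apply/continuous_closedP => A clA.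
rewrite (_ : g @^-1` A = f @` A).
  apply: compact_closed => //; apply: continuous_compact.
    exact: continuous_subspaceT.
  exact: subclosed_compact clA one_point_compactification_compact _.
apply/seteqP; split=> [y Ay|_ [z Az <-]]; first by exists (g y).
by rewrite /= (_ : g (f z) = z)//; apply: fI.
Qed.

End OnePoint.

(** * Maximal ideals of C(Y) are the points of Y *)

Section MaximalIdealsOfC.
Context {R : realType} {Y : topologicalType}.
Hypothesis cY : compact [set: Y].

Definition evaluation_ideal (y : Y) : set (Calg R Y) :=
  vanish (lid (Calg R Y)) [set y].

Lemma evaluation_idealP y (f : Calg R Y) : evaluation_ideal y f <-> f y = 0.
Proof. exact: (vanish1P (lid (Calg R Y))). Qed.

Lemma evaluation_ideal_maximal y : maximal_lideal (evaluation_ideal y).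
Proof. exact: vanish1_maximal. Qed.

Lemma evaluation_ideal_inj : hausdorff_space Y -> injective evaluation_ideal.
Proof.
move=> hY y z yz; apply: contrapT => nyz.
have oz : open (~` [set z]).
  exact/closed_openC/accessible_closed_set1/hausdorff_accessible.
have [f [fy fz _]] := compact_hausdorff_separation cY hY R oz nyz.
have : evaluation_ideal z f by apply/evaluation_idealP/fz; apply.
by rewrite -yz => /evaluation_idealP; rewrite fy => /eqP; rewrite oner_eq0.
Qed.

(** If [M] had no common zero, scaled squares from [M] would exceed 1 locally; sums make this family
    directed, so by compactness one member of [M] exceeds 1 everywhere, which forces [1] into
    [M]. *)
Lemma maximal_lideal_evaluation (M : set (Calg R Y)) :
  maximal_lideal M -> exists y, M = evaluation_ideal y.
Proof.
move=> maxM; have [Mid MT _] := maxM; have [M0 MD MM Mabs] := Mid.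
have [[y My]|nex] := pselect (exists y, M `<=` evaluation_ideal y).
  by exists y; apply: maximal_lideal_sub => //; exact: evaluation_ideal_maximal.
exfalso; apply: MT; apply: lideal_one => //.
have [|||k [Mk _] k1] := @compact_directed_cover Y (Calg R Y)
  [set f | M f /\ forall y, 0 <= f y] (fun f => [set y | 1 < f y]) _ cY.
- by exists 0.
- move=> f g [Mf f0] [Mg g0]; exists (f + g).
    by split; [exact: MD|move=> y; rewrite funAlgD addr_ge0].
  move=> y fgy; change (1 < (f + g) y); rewrite funAlgD.
  by have := f0 y; have := g0 y; case: fgy => /=; lra.
- move=> y _; have [f Mf fy] : exists2 f, M f & f y <> 0.
    apply: contrapT => nf; apply: nex; exists y => f Mf.
    by apply/evaluation_idealP; apply: contrapT => fy; apply: nf; exists f.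
  have f2 : 0 < f y ^+ 2 by rewrite exprn_even_gt0//=; exact/eqP.
  (* The factor gives the value 2 at [y], hence more than 1 nearby. *)
  exists ((2 / f y ^+ 2) *: (f * f)).
    split; first by apply: lideal_scale => //; case: (MM f _ Mf).
    move=> z; rewrite funAlgZ funAlgM mulr_ge0//; last exact: sqr_ge0.
    by rewrite divr_ge0// ltW.
  have cg := @Calg_continuous R Y ((2 / f y ^+ 2) *: (f * f)).
  suff : nbhs y ((((2 / f y ^+ 2) *: (f * f) : Calg R Y) : Y -> R)
      @^-1` [set r | 1 < r]).
    by [].
  apply: cg; apply: lt_nbhsr; rewrite funAlgZ funAlgM -expr2 divfK ?gt_eqF//.
  by rewrite ltr1n.
apply: Mabs Mk; apply/funAlg_leP => y; rewrite !funAlg_abs funAlg1 normr1.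
by apply: le_trans (ler_norm _); apply/ltW/k1.
Qed.

End MaximalIdealsOfC.

(** * Compact elements of C(Y) and the ideal they determine *)

Section CompactElements.
Context {R : realType} {X Y : topologicalType} {e : X -> Y}.
Variable ce : compactification e.
Hypothesis X0 : inhabited X.
Local Notation alpha := (eflat R ce).

Let cY : compact [set: Y]. Proof. by case: ce. Qed.
Let hY : hausdorff_space Y. Proof. by case: ce. Qed.
Let econt : continuous e. Proof. by case: ce => _ _ []. Qed.
Let edense : dense (range e). Proof. by case: ce. Qed.

(* The functions vanishing near [p] have a constant join in [B(X)], but finite
   joins of them still vanish near [p]. *)
Lemma Icompact_remainder (a : Calg R Y) p :
  ~ range e p -> Icompact alpha a -> a p = 0.
Proof.
move=> pe Ia; apply: contrapT => ap.
have [M aM] := Balg_bounded (alpha a).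
have M0 : 0 <= M.
  by case: X0 => x; apply: le_trans (normr_ge0 _) (aM x).
(* The level [M + 1] leaves room for [eps = 1] above the bound [M] of [alpha a]. *)
pose T := [set t : Calg R Y | [/\ 0 <= t, t <= lreal (Calg R Y) (M + 1) &
  nbhs p [set z | t z = 0]]].
have supT : supremums (alpha @` T) (lreal (Balg R X) (M + 1)).
  split=> [_ [t [_ tM _] <-]|c cub].
    apply/funAlg_leP => x; rewrite funAlg_real eflatE.
    by have /funAlg_leP/(_ (e x)) := tM; rewrite funAlg_real.
  apply/funAlg_leP => x; rewrite funAlg_real.
  have pex : p <> e x by move=> pex; apply: pe; exists x.
  have [f [fx fp f01]] := compact_hausdorff_bump cY hY R pex.
  have /funAlg_leP/(_ x) : alpha ((M + 1) *: f) <= c.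
    apply: cub; exists ((M + 1) *: f) => //; split.
    - apply/funAlg_leP => z; rewrite funAlgZ funAlg0.
      by have /andP[? _] := f01 z; rewrite mulr_ge0// addr_ge0.
    - apply/funAlg_leP => z; rewrite funAlgZ funAlg_real.
      by have /andP[? ?] := f01 z; rewrite ler_piMr// addr_ge0.
    - apply: filterS fp => z fz; change (((M + 1) *: f) z = 0).
      by rewrite funAlgZ (_ : f z = 0) ?mulr0.
  by rewrite eflatE funAlgZ fx mulr1.
have T0 t : T t -> 0 <= t by case.
have [|T' [finT' T'T [s supT' as']]] := Ia 1 T _ ltr01 T0 supT.
  apply/funAlg_leP => x; rewrite funAlgD !funAlg_real funAlg_abs lerD2r.
  exact: aM.
have nT' : nbhs p [set z | forall t, T' t -> t z = 0].
  have /finite_fsetP[D DE] := finT'.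
  have : nbhs p (\bigcap_(t in [set` D]) [set z | (t : Calg R Y) z = 0]).
    by apply: filter_bigI => t tD; have /T'T[] : T' t by rewrite DE.
  by apply: filterS => z zD t; rewrite DE => /zD.
have na : nbhs p ((a : Y -> R) @^-1` [set r | r != 0]).
  apply: (@Calg_continuous R Y a); apply: open_nbhs_nbhs; split.
    exact: open_neq.
  exact/eqP.
(* By density, e[X] has a point in this neighbourhood: [a] is nonzero there while every member of
   [T'] vanishes. *)
have : nbhs p ([set z | forall t, T' t -> t z = 0] `&`
    (a : Y -> R) @^-1` [set r | r != 0]) by exact: filterI.
rewrite nbhsE => -[W [oW Wp] WI].
have [z [Wz [x _ xz]]] := edense (ex_intro _ p Wp) oW; subst z.
have [T'x /eqP ax] := WI _ Wz.
have ax0 : 0 < `|a (e x)| by rewrite normr_gt0; exact/eqP.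
have [_ [t /T'x tx <-]] := Balg_supremumsP x supT' ax0.
rewrite eflatE tx subr_lt0 ltNge.
by have /funAlg_leP/(_ x) := as'; rewrite funAlg_abs eflatE => ->.
Qed.

(** The slack [eps] gives at each point a member of [T] strictly above the absolute value of [a].
    This is an open condition, so finitely many members suffice on [K], and off [K] the element [a]
    is 0. *)
Lemma compact_support_Icompact (a : Calg R Y) (K : set Y) :
  compact K -> K `<=` range e -> (forall y, ~ K y -> a y = 0) ->
  Icompact alpha a.
Proof.
move=> cK Ke aK eps T s eps0 T0 supT as_.
have sT x : exists2 t, T t & `|a (e x)| < t (e x).
  have [_ [t Tt <-] st] := Balg_supremumsP x supT eps0.
  exists t => //; apply: le_lt_trans st; rewrite lerBrDr.
  by have /funAlg_leP/(_ x) := as_; rewrite funAlgD funAlg_real funAlg_abs.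
have [x0] := X0; have [t0 Tt0 _] := sT x0.
have [|T1 [finT1 T1T KT1]] := @compact_finite_cover Y (Calg R Y) T
    (fun t => [set y | `|a y| < t y]) K cK.
  move=> y /Ke[x _ <-]; have [t Tt tx] := sT x; exists t => //.
  have cta : continuous (fun y => t y - `|a y|).
    move=> z; apply: cvgB; first exact: Calg_continuous.
    by apply: cvg_norm; exact: Calg_continuous.
  have : nbhs (e x) ((fun y => t y - `|a y|) @^-1` [set r | 0 < r]).
    by apply: cta; apply: lt_nbhsr; rewrite subr_gt0.
  by apply: filterS => z; rewrite /= subr_gt0.
(* Adding [t0] keeps the finite set nonempty, so that its join exists, and makes the join
   nonnegative off [K]. *)
have T'T : T1 `|` [set t0] `<=` T by move=> t [/T1T|->].
have [|s' supT'] := @Balg_dedekind_complete R X (alpha @` (T1 `|` [set t0])).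
  split; first by exists (alpha t0), t0 => //; right.
  by exists s => _ [t /T'T Tt <-]; apply: (proj1 supT); exists t.
exists (T1 `|` [set t0]); split=> //.
  by rewrite finite_setU; split=> //; exact: finite_set1.
exists s' => //; apply/funAlg_leP => x; rewrite funAlg_abs eflatE.
have ts' t : (T1 `|` [set t0]) t -> t (e x) <= s' x.
  by move=> T't; rewrite -eflatE; apply/funAlg_leP; apply: (proj1 supT'); exists t.
have [/KT1[t T1t /ltW tx]|/aK->] := pselect (K (e x)).
  by apply: le_trans tx _; apply: ts'; left.
rewrite normr0; apply: le_trans (ts' t0 _); last by right.
by have /funAlg_leP/(_ (e x)) := T0 _ Tt0.
Qed.

(** The maximal ideal is evaluation at some [p]. Local compactness at [1] gives a compact element
    positive at [e x], so [p] is not in e[X]; compact elements vanish at any point [q] outside e[X],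
    so the ideal of [q] contains that of [p] and [q = p]. *)
Lemma locally_compact_remainder :
  locally_compact_extension alpha -> maximal_lideal (Jl (Icompact alpha)) ->
  exists p, range e = ~` [set p].
Proof.
move=> [_ lc] maxJ.
have [p JE] := maximal_lideal_evaluation cY maxJ; exists p.
have IJ : Icompact alpha `<=` Jl (Icompact alpha) by move=> a Ia M [_]; exact.
apply/seteqP; split=> [_ [x _ <-] /= xp|q qp].
  have [|_ [a [Ia _] <-]] := Balg_supremumsP x (lc 1 _) (ltr01 : 0 < 1 :> R).
    by apply/funAlg_leP => y; exact: ler01.
  rewrite (eflatE ce 1 x) (eflatE ce a x) funAlg1 subrr xp.
  have /evaluation_idealP -> : evaluation_ideal p a by rewrite -JE; exact: IJ.
  by rewrite ltxx.
apply: contrapT => qe; apply: qp; apply: (@evaluation_ideal_inj R Y cY hY).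
rewrite -JE; symmetry; apply: maximal_lideal_sub => //.
  exact: evaluation_ideal_maximal.
move=> f; apply; split; first exact: evaluation_ideal_maximal.
by move=> a Ia; apply/evaluation_idealP; exact: Icompact_remainder Ia.
Qed.

Variable p : Y.
Hypothesis eE : range e = ~` [set p].

Lemma vanishing_near_Icompact (a : Calg R Y) :
  nbhs p [set z | a z = 0] -> Icompact alpha a.
Proof.
rewrite nbhsE => -[W [oW Wp] Wa].
apply: (@compact_support_Icompact a (~` W)).
- exact: subclosed_compact (open_closedC oW) cY _.
- by move=> y Wy; rewrite eE => yp; apply: Wy; rewrite yp.
- by move=> y /contrapT /Wa.
Qed.

Let pex x : p <> e x.
Proof. by move=> px; have : range e (e x) by [exists x]; rewrite eE -px; apply. Qed.

(** Multiplying [b] by a bump that is 1 at [e x] and 0 near [p] gives a compact element below [b]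
    with the same value at [e x]. *)
Lemma remainder_locally_compact_extension : hausdorff_space X ->
  locally_compact_extension alpha.
Proof.
move=> hX; split=> [|b b0]; first exact: eflat_basic_extension.
split=> [_ [a [_ ab] <-]|c cub]; first exact: lhom_le.
apply/funAlg_leP => x.
have [f [fx fp f01]] := compact_hausdorff_bump cY hY R (@pex x).
have /funAlg_leP/(_ x) : alpha (f * b) <= c.
  apply: cub; exists (f * b) => //; split.
    apply: vanishing_near_Icompact; apply: filterS fp => z fz.
    by change ((f * b) z = 0); rewrite funAlgM (_ : f z = 0) ?mul0r.
  apply/funAlg_leP => z; have /funAlg_leP/(_ z) bz := b0.
  by have /andP[_ ?] := f01 z; rewrite funAlgM ler_piMl.
by rewrite eflatE funAlgM fx mul1r.
Qed.

(** For [y] other than [p], a bump at [y] vanishing near [p] is compact and lies outside the ideal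
    of [y]; so only the ideal of [p] contains all compact elements. *)
Lemma remainder_Jl : Jl (Icompact alpha) = evaluation_ideal p.
Proof.
have pe : ~ range e p by rewrite eE; apply.
apply/seteqP; split=> [f|f fp M [maxM IM]].
  apply; split; first exact: evaluation_ideal_maximal.
  by move=> a Ia; apply/evaluation_idealP; exact: Icompact_remainder Ia.
have [y ME] := maximal_lideal_evaluation cY maxM.
suff -> : M = evaluation_ideal p by [].
rewrite ME; congr evaluation_ideal; apply: contrapT => yp.
have [x _ xy] : range e y by rewrite eE.
have [g [gx gp _]] := compact_hausdorff_bump cY hY R (@pex x).
have : M g by apply/IM/vanishing_near_Icompact.
by rewrite ME => /evaluation_idealP; rewrite -xy gx => /eqP; rewrite oner_eq0.
Qed.

End CompactElements.

(** * Minimality when exactly one point is missing *)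

Section Minimality.
Context {R : realType} {X Y : topologicalType} {e : X -> Y}.
Variables (ce : compactification e) (p : Y).
Hypothesis eE : range e = ~` [set p].
Local Notation alpha := (eflat R ce).

Let cY : compact [set: Y]. Proof. by case: ce. Qed.
Let econt : continuous e. Proof. by case: ce => _ _ []. Qed.

Section Compatible.
Variables (C : lAlgebra R) (gamma : lAlgHom C (Balg R X)).
Hypothesis gI : injective gamma.
Hypothesis gopen : range (cozero_union gamma) = open.

(** The set is the cozero set of the positive part of [c - r], hence open by [gopen]. *)
Let superlevel (c : C) (r : R) x : r < gamma c x -> nbhs x [set z | r < gamma c z].
Proof.
move=> rx; pose d : C := Order.join (c - lreal C r : C) (0 : C).
have dE z : gamma d z = Num.max (gamma c z - r) 0.
  by rewrite lhomU funAlgU lhomB lhom_real lhom0 funAlgB funAlg_real funAlg0.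
have od : open (cozero_union gamma [set d]) by rewrite -gopen; exists [set d].
have dx : cozero_union gamma [set d] x.
  exists d => //; rewrite dE; apply/eqP; rewrite gt_eqF// lt_max subr_gt0.
  by rewrite rx.
have : nbhs x (cozero_union gamma [set d]) by apply: open_nbhs_nbhs.
apply: filterS => z [_ -> dz]; change (r < gamma c z).
rewrite ltNge; apply/negP => cz; apply: dz; rewrite dE; apply/max_idPr.
by rewrite subr_le0.
Qed.

Let separation (U : set X) x : open U -> U x ->
  exists2 c, gamma c x <> 0 & forall z, ~ U z -> gamma c z = 0.
Proof.
rewrite -gopen => -[E _ <-] [c Ec cx]; exists c => // z nz.
by apply: contrapT => cz; apply: nz; exists c.
Qed.

(* The Stone-Weierstrass step: off the compact set [f >= eps] the function [0]
   is already a good approximation, and on it a finite join of bumps is. *)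
Let approximation (f : Calg R Y) (eps : R) : 0 <= f -> f p = 0 -> 0 < eps ->
  exists c, forall x, `|gamma c x - alpha f x| <= eps.
Proof.
move=> /funAlg_leP f0 fp eps0.
have cf := @Calg_continuous R Y f.
have cK : compact (e @^-1` ((f : Y -> R) @^-1` [set r | eps <= r])).
  apply: (embedding_compact_preimage ce).
    apply: subclosed_compact cY _ => //.
    exact: (continuous_closedP (f : Y -> R)).1 cf _ (@closed_ge R eps).
  move=> y fy; have {}fy : eps <= f y := fy.
  by rewrite eE => yp; move: fy; rewrite yp fp leNgt eps0.
have fe_near x r : r < f (e x) -> nbhs x [set z | r < f (e z)].
  move=> rx; suff : nbhs x (e @^-1` ((f : Y -> R) @^-1` [set s | r < s])) by [].
  by apply: econt; apply: cf; apply: lt_nbhsr.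
have fe_near' x r : f (e x) < r -> nbhs x [set z | f (e z) < r].
  move=> rx; suff : nbhs x (e @^-1` ((f : Y -> R) @^-1` [set s | s < r])) by [].
  by apply: econt; apply: cf; apply: lt_nbhsl.
have [|||k Dk Kk] := @compact_directed_cover X C
  [set c | forall x, 0 <= gamma c x <= f (e x) + eps]
  (fun c => [set x | f (e x) - eps < gamma c x]) _ cK.
- exists 0 => x; rewrite lhom0 funAlg0 lexx addr_ge0//; last exact: ltW.
  exact: f0.
- move=> c d cD dD; exists (Order.join (c : C) (d : C)).
    move=> x; have /andP[? ?] := cD x; have /andP[? ?] := dD x.
    by rewrite lhomU funAlgU le_max ge_max; apply/and3P; split=> //; apply/orP; left.
  move=> x cdx; change (f (e x) - eps < gamma (Order.join (c : C) (d : C)) x).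
  by rewrite lhomU funAlgU lt_max; case: cdx => /= ->; rewrite ?orbT.
- move=> x _.
  have [U [oU Ux Uf]] : exists U, [/\ open U, U x &
      forall z, U z -> f (e x) - eps < f (e z)].
    have : nbhs x [set z | f (e x) - eps < f (e z)] by apply: fe_near; lra.
    by rewrite nbhsE => -[U [oU Ux] Uf]; exists U; split.
  have [c0 c0x c0U] := separation oU Ux.
  (* The scaled square has the value [f (e x)] at [x] and vanishes off [U]; capping it at [f (e x)]
     keeps it below [f + eps] on [U]. *)
  pose c : C := Order.meet ((f (e x) / gamma c0 x ^+ 2) *: (c0 * c0) : C)
                           (lreal C (f (e x)) : C).
  have cE z : gamma c z =
      Num.min (f (e x) / gamma c0 x ^+ 2 * gamma c0 z ^+ 2) (f (e x)).
    by rewrite lhomI funAlgI lhomZ lhomM lhom_real funAlgZ funAlgM funAlg_real.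
  have fx0 : 0 <= f (e x) by exact: f0.
  exists c.
    move=> z; rewrite cE; apply/andP; split.
      by rewrite le_min fx0 andbT mulr_ge0 ?sqr_ge0// divr_ge0 ?sqr_ge0.
    rewrite ge_min; have [/Uf fz|/c0U ->] := pselect (U z).
      by apply/orP; right; lra.
    by rewrite expr0n/= mulr0 addr_ge0 ?(ltW eps0)//; exact: f0.
  have cx : gamma c x = f (e x).
    by rewrite cE divfK ?minxx// sqrf_eq0; exact/eqP.
  (* Near [x] both [r < gamma c] and [f < r + eps] hold, whence [f - eps < gamma c] there. *)
  pose r := f (e x) - eps / 2.
  have rc : r < gamma c x by rewrite cx /r; lra.
  have fr : f (e x) < r + eps by rewrite /r; lra.
  apply: filterS (filterI (superlevel rc) (fe_near' _ _ fr)) => z [/= rz fz].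
  lra.
exists k => x; rewrite eflatE.
have /andP[k0 kf] := Dk x.
have [fx|fx] := leP eps (f (e x)).
  have : f (e x) - eps < gamma k x by exact: Kk.
  by rewrite ler_norml => ?; apply/andP; split; lra.
by rewrite ler_norml; apply/andP; split; lra.
Qed.

Hypothesis ucC : uniformly_complete C.

(** Up to the constant [f p], the function is the difference of its positive and negative parts,
    which are nonnegative and vanish at [p]. *)
Lemma compatible_contains_C (f : Calg R Y) : exists c, gamma c = alpha f.
Proof.
have pos (g : Calg R Y) : 0 <= g -> g p = 0 -> exists c, gamma c = alpha g.
  move=> g0 gp; apply: uniformly_complete_closed => // eps eps0.
  exact: approximation.
pose g : Calg R Y := f - lreal (Calg R Y) (f p).
have gp : g p = 0 by rewrite funAlgB funAlg_real subrr.
pose gpos : Calg R Y := Order.join (g : Calg R Y) (0 : Calg R Y).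
pose gneg : Calg R Y := Order.join (- g : Calg R Y) (0 : Calg R Y).
have [||c1 c1E] := pos gpos.
- by apply/funAlg_leP => y; rewrite funAlgU funAlg0 le_max lexx orbT.
- by rewrite funAlgU gp funAlg0 maxxx.
have [||c2 c2E] := pos gneg.
- by apply/funAlg_leP => y; rewrite funAlgU funAlg0 le_max lexx orbT.
- by rewrite funAlgU funAlgN gp funAlg0 oppr0 maxxx.
exists (c1 - c2 + lreal C (f p)).
rewrite lhomD lhomB c1E c2E lhom_real -(lhom_real alpha) -lhomB -lhomD.
congr (alpha _); apply: funInP => y.
rewrite funAlgD funAlgB !funAlgU funAlgN funAlgB !funAlg_real funAlg0.
by case: (leP 0 (f y - f p)) => h;
  [rewrite (max_idPr _)|rewrite (max_idPl _)]; lra.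
Qed.

(** Preimages under the injective [gamma] are unique, so choosing them respects all operations. *)
Lemma compatible_factor : exists delta : lAlgHom (Calg R Y) C,
  gamma \o delta =1 alpha.
Proof.
have /choice[d dE] := compatible_contains_C.
have dD a b : d (a + b) = d a + d b by apply: gI; rewrite lhomD !dE lhomD.
have dZ (r : R) a : d (r *: a) = r *: d a by apply: gI; rewrite lhomZ !dE lhomZ.
have dM a b : d (a * b) = d a * d b by apply: gI; rewrite lhomM !dE lhomM.
have d1 : d 1 = 1 by apply: gI; rewrite dE !lhom1.
have dI a b : d (Order.meet a b) = Order.meet (d a) (d b).
  by apply: gI; rewrite lhomI !dE lhomI.
have dU a b : d (Order.join a b) = Order.join (d a) (d b).
  by apply: gI; rewrite lhomU !dE lhomU.
by exists (LAlgHom dD dZ dM d1 dI dU).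
Qed.

End Compatible.

Lemma remainder_minimal : hausdorff_space X -> minimal_extension alpha.
Proof.
move=> hX; split=> [|C gamma [balC ucC] [_ _ gmono _] comp].
  exact: eflat_basic_extension.
apply: compatible_factor => //; first exact: monomorphism_injective.
rewrite -(proj1 (compatibleP alpha gamma) comp); apply: cozero_union_open.
  exact: eflat_continuous.
exact: eflat_separation.
Qed.

End Minimality.

(** * The equivalence of the three conditions, each compared with a single missing point *)

Theorem theorem5p24 (R : realType) (X Y : topologicalType) (e : X -> Y)
    (crX : completely_regular_space X) (hX : hausdorff_space X)
    (ncX : ~ compact [set: X]) (ce : compactification e) :
  let alpha := eflat R ce in
  [<-> minimal_extension alpha;
       locally_compact [set: X] /\
         equivalent_compactifications e
           (Some : X -> one_point_compactification X);
       locally_compact_extension alpha /\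
         maximal_lideal (Jl (Icompact alpha))].
Proof.
move=> alpha; have X0 := noncompact_point ncX.
tfae.
- move=> /(minimal_remainder hX ncX)[p eE]; split.
    exact: remainder_locally_compact ce _ eE R.
  exact: remainder_one_point eE.
- move=> [_ /one_point_remainder[p eE]]; split.
    exact: remainder_locally_compact_extension eE hX.
  rewrite (remainder_Jl ce X0 eE); exact: evaluation_ideal_maximal.
- move=> [lc maxJ]; have [p eE] := locally_compact_remainder X0 lc maxJ.
  exact: remainder_minimal eE hX.
Qed.
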